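(* Let $\mathbf{k}$ be a field whose characteristic is not $2$, and let $(\mathfrak g,[\,,\,]_{\mathfrak g},\beta_{\mathfrak g})$ be an involutive Hom-Lie algebra over $\mathbf{k}$. Let $(T^+_h(\mathfrak g),\odot,\alpha_T)$ be the Hom-tensor algebra on $\mathfrak g$, let $\varphi:T^+_h(\mathfrak g)\to T^+_h(\mathfrak g)$ be the twist operator, let $I_{\mathfrak g,\beta}$ be the Hom-ideal of $T^+_h(\mathfrak g)$ generated by $\{x\otimes y-y\otimes x-[x,y]_{\mathfrak g}\mid x,y\in\mathfrak g\}$, and let $J_{\mathfrak g,\beta}$ be the subspace of $T^+_h(\mathfrak g)$ spanned by the elements $$\mathfrak a\otimes(x\otimes y-y\otimes x)\otimes\mathfrak b-\alpha_T(\mathfrak a)\otimes[x,y]_{\mathfrak g}\otimes\alpha_T(\mathfrak b),\qquad \mathfrak a\in\mathfrak g^{\otimes i},\ \mathfrak b\in\mathfrak g^{\otimes j},\ i,j\ge0,\ x,y\in\mathfrak g$$ (all as defined in the context). Then there is a well-ordered basis $X=\{x_i\mid i\in\omega\}$ of $\mathfrak g$, indexed by a well-ordered set $\omega$, such that, for $$W:=\{x_{i_1}\otimes\cdots\otimes x_{i_n}\mid i_1\ge\cdots\ge i_n,\ n\ge1\},$$ the following statements hold. (1) $T^+_h(\mathfrak g)=J_{\mathfrak g,\beta}\oplus\mathbf{k}W$, where $\mathbf{k}W$ is the linear span of $W$. (2) (PBW Theorem) $\varphi(W)$ is a basis of $T^+_h(\mathfrak g)/I_{\mathfrak g,\beta}$,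 that is, the cosets of the elements $\varphi(w)$, $w\in W$, form a basis of this quotient.
   Context: A Hom-Lie algebra is a triple $(\mathfrak g,[\,,\,]_{\mathfrak g},\beta_{\mathfrak g})$ with $[\,,\,]_{\mathfrak g}$ bilinear on the $\mathbf{k}$-module $\mathfrak g$ and $\beta_{\mathfrak g}:\mathfrak g\to\mathfrak g$ linear such that for all $x,y,z\in\mathfrak g$: $[x,y]_{\mathfrak g}=-[y,x]_{\mathfrak g}$; $[\beta_{\mathfrak g}(x),[y,z]_{\mathfrak g}]_{\mathfrak g}+[\beta_{\mathfrak g}(y),[z,x]_{\mathfrak g}]_{\mathfrak g}+[\beta_{\mathfrak g}(z),[x,y]_{\mathfrak g}]_{\mathfrak g}=0$; and $\beta_{\mathfrak g}([x,y]_{\mathfrak g})=[\beta_{\mathfrak g}(x),\beta_{\mathfrak g}(y)]_{\mathfrak g}$. It is involutive if $\beta_{\mathfrak g}^2=\mathrm{id}$. The Hom-tensor algebra: $T^+_h(\mathfrak g):=\bigoplus_{n\ge1}\mathfrak g^{\otimes n}$; $\alpha_T$ is the linear operator with $\alpha_T(a_1\otimes\cdots\otimes a_n)=\beta_{\mathfrak g}(a_1)\otimes\cdots\otimes\beta_{\mathfrak g}(a_n)$; and $\odot$ is the bilinear operation defined on pure tensors $\mathfrak a\in\mathfrak g^{\otimes m}$, $\mathfrak b=b_1\otimes\cdots\otimes b_n\in\mathfrak g^{\otimes n}$ by induction on $n$: $\mathfrak a\odot\mathfrak b:=\mathfrak a\otimes\mathfrak b$ for $n=1$, and $\mathfrak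 a\odot\mathfrak b:=\big(\alpha_T(\mathfrak a)\odot(b_1\otimes\cdots\otimes b_k)\big)\otimes\alpha_T(b_{k+1})$ for $n=k+1$, $k\ge1$. A Hom-ideal of $T^+_h(\mathfrak g)$ is a subspace $I$ with $u\odot v\in I$ and $v\odot u\in I$ for all $u\in I$, $v\in T^+_h(\mathfrak g)$, and $\alpha_T(I)\subseteq I$; the Hom-ideal generated by a set is the smallest Hom-ideal containing it. The quotient $T^+_h(\mathfrak g)/I_{\mathfrak g,\beta}$ is the universal enveloping Hom-associative algebra of $\mathfrak g$. The twist operator $\varphi$ is the linear operator on $T^+_h(\mathfrak g)$ with $\varphi(a_1\otimes\cdots\otimes a_n)=\tilde a_1\otimes\cdots\otimes\tilde a_n$, where $\tilde a_i=\beta_{\mathfrak g}(a_i)$ if $i$ is odd and $i\ge3$, and $\tilde a_i=a_i$ otherwise. Convention: $\mathfrak g^{\otimes0}=\mathbf{k}$, on which $\alpha_T$ acts as the identity, with $1\otimes u=u=u\otimes 1$. *)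

(* Defs.v *)
From HB Require Import structures.
From mathcomp Require Import all_boot all_algebra sesquilinear.
From mathcomp Require Import generic_quotient ring_quotient finmap boolp classical_sets wochoice.
From mathcomp.multinomials Require Import monalg.

Set Implicit Arguments.
Unset Strict Implicit.
Unset Printing Implicit Defensive.

Import GRing.Theory.

Local Open Scope classical_set_scope.
Local Open Scope quotient_scope.
Local Open Scope ring_scope.

Section LinearAlgebra.
Variables (k : fieldType) (V : lmodType k).

Definition subspace (S : set V) : Prop :=
  S 0 /\ forall a u v, S u -> S v -> S (a *: u + v).

Definition lspan (A : set V) : set V := smallest subspace A.

Lemma smallest_subspace (P : set V -> Prop) (A : set V) :
  (forall S, P S -> subspace S) -> subspace (smallest P A).
Proof.
move=> PS; split=> [S [/PS[]]//|a u v Su Sv S [PSS AS]].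
by apply: (PS _ PSS).2; [apply: Su|apply: Sv].
Qed.

Lemma lspan_subspace A : subspace (lspan A).
Proof. exact: smallest_subspace. Qed.

Lemma lspan_id S : subspace S -> lspan S = S.
Proof. exact: smallest_id. Qed.

Definition is_direct_sum (S A B : set V) : Prop :=
  S = [set a + b | a in A & b in B] /\ A `&` B = [set 0].

(* The family (e i), i in D, is a basis of the subspace S; distinct indices
   count as distinct vectors, so e is injective on D. *)
Definition is_basis (I : choiceType) (D : set I) (e : I -> V) (S : set V) :=
  (forall (s : seq I) (c : I -> k), uniq s -> {in s, forall i, D i} ->
     \sum_(i <- s) c i *: e i = 0 -> {in s, forall i, c i = 0})
  /\ lspan (e @` D) = S.

Lemma scale_add_swap (a b : k) (x y z w : V) :
  b *: (a *: x + y) + (a *: z + w) = a *: (b *: x + z) + (b *: y + w).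
Proof. by rewrite !scalerDr !scalerA (mulrC b) addrACA. Qed.

Definition spanb (A : set V) : {pred V} := [pred v | v \in lspan A].

Lemma spanb_submod_closed A : submod_closed (spanb A).
Proof.
have [S0 SP] := lspan_subspace A; split; first exact: mem_set.
by move=> a u v; rewrite !inE; apply: SP.
Qed.
HB.instance Definition _ A :=
  GRing.isSubmodClosed.Build k V (spanb A) (spanb_submod_closed A).

End LinearAlgebra.

(* Locking keeps unification from unfolding quotients down to representatives. *)
Fact quo_key : unit. Proof. by []. Qed.

(* The quotient of V by the subspace spanned by A; it is V / A when A is a
   subspace. *)
Section QuotientModule.
Variables (k : fieldType) (V : lmodType k) (A : set V).

Definition quo : Type := Quotient.quot (spanb A).
HB.instance Definition _ := GRing.Zmodule.on quo.

Definition coset : V -> quo :=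
  locked_with quo_key (\pi_(Quotient.quot (spanb A))).
Definition coset_repr : quo -> V :=
  locked_with quo_key (@repr _ (Quotient.quot (spanb A))).

Lemma cosetE : coset = \pi_(Quotient.quot (spanb A)).
Proof. by rewrite /coset unlock. Qed.

Lemma coset_reprK : cancel coset_repr coset.
Proof.
rewrite cosetE /coset_repr unlock.
exact: (@reprK _ (Quotient.quot (spanb A))).
Qed.

Lemma cosetP u v : coset u = coset v <-> lspan A (u - v).
Proof.
rewrite cosetE; split=> [/eqP|h].
  by rewrite -Quotient.idealrBE inE.
by apply/eqP; rewrite -Quotient.idealrBE inE.
Qed.

Lemma cosetB : {morph coset : u v / u - v}.
Proof. rewrite cosetE; exact: (raddfB (\pi_(Quotient.quot (spanb A)))). Qed.

Lemma cosetD : {morph coset : u v / u + v}.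
Proof. rewrite cosetE; exact: (raddfD (\pi_(Quotient.quot (spanb A)))). Qed.

Definition quo_scale a (q : quo) := coset (a *: coset_repr q).

Lemma coset_scale a v : coset (a *: v) = quo_scale a (coset v).
Proof.
apply/cosetP; rewrite -scalerBr -[_ *: _]addr0.
have [S0 SP] := lspan_subspace A; apply: (SP) => //.
by apply/cosetP; rewrite coset_reprK.
Qed.

Lemma quo_scaleA a b q : quo_scale a (quo_scale b q) = quo_scale (a * b) q.
Proof. by rewrite -[q]coset_reprK -!coset_scale scalerA. Qed.
Lemma quo_scale1 : left_id 1 quo_scale.
Proof. by move=> q; rewrite -[q]coset_reprK -coset_scale scale1r. Qed.
Lemma quo_scaleDr : right_distributive quo_scale +%R.
Proof.
move=> a q r; rewrite -[q]coset_reprK -[r]coset_reprK.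
by rewrite -cosetD -!coset_scale -cosetD scalerDr.
Qed.
Lemma quo_scaleDl q : {morph quo_scale^~ q : a b / a + b}.
Proof. by move=> a b; rewrite -[q]coset_reprK -!coset_scale -cosetD scalerDl. Qed.

HB.instance Definition _ := GRing.Zmodule_isLmodule.Build k quo
  quo_scaleA quo_scale1 quo_scaleDr quo_scaleDl.

Lemma coset_is_linear : linear coset.
Proof. by move=> a u v; rewrite cosetD coset_scale. Qed.
HB.instance Definition _ :=
  GRing.isLinear.Build k V quo *:%R coset coset_is_linear.

End QuotientModule.

Section TensorAlgebra.
Variables (k : fieldType) (g : lmodType k).
Implicit Types (s w : seq g) (a : k) (x y : g).

Definition word_multilinear (V : lmodType k) (F : seq g -> V) : Prop :=
  forall s1 s2 a x y,
    F (s1 ++ (a *: x + y) :: s2) = a *: F (s1 ++ x :: s2) + F (s1 ++ y :: s2).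

Definition tens_rel : set {malg k[seq g]} :=
  [set r | exists s1 s2 a x y,
    r = << s1 ++ (a *: x + y) :: s2 >>
        - (a *: << s1 ++ x :: s2 >> + << s1 ++ y :: s2 >>)].

(* The direct sum of all tensor powers of g, in degrees n >= 0: the free module
   on the words over g modulo multilinearity of words in each letter.  The
   relations preserve the length of words, so the quotient is graded by it. *)
Definition tens : Type := quo tens_rel.
HB.instance Definition _ := GRing.Lmodule.on tens.

(* The pure tensor a_1 (x) ... (x) a_n of the word [:: a_1; ...; a_n]; the
   empty word gives 1 in degree 0. *)
Definition ptens (s : seq g) : tens := coset tens_rel << s >>.

Definition tpow (n : nat) : set tens := lspan (ptens @` [set s | size s = n]).

Definition tplus : set tens := lspan (ptens @` [set s | s != [::]]).

Section Lift.
Variable V : lmodType k.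

Definition free_lift (F : seq g -> V) (p : {malg k[seq g]}) : V :=
  \sum_(w <- msupp p) p@_w *: F w.

(* The linear extension of F from pure tensors to all tensors, meaningful when
   F is multilinear in the letters (tens_lift_linear, tens_lift_ptens). *)
Definition tens_lift : (seq g -> V) -> tens -> V :=
  locked_with quo_key (fun F t => free_lift F (coset_repr t)).

Variable F : seq g -> V.

Lemma free_liftEw (d : {fset seq g}) p :
  (msupp p `<=` d)%fset -> free_lift F p = \sum_(w <- d) p@_w *: F w.
Proof.
move=> le_pd; rewrite /free_lift (big_fset_incl _ le_pd) // => w _ wNp.
by rewrite mcoeff_outdom // scale0r.
Qed.

Lemma free_lift_linear : linear (free_lift F).
Proof.
move=> a p q; set d := (msupp p `|` msupp q `|` msupp (a *: p + q))%fset.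
have dp : (msupp p `<=` d)%fset by rewrite /d -fsetUA fsubsetUl.
have dq : (msupp q `<=` d)%fset by rewrite /d fsetUAC fsubsetUr.
have dpq : (msupp (a *: p + q) `<=` d)%fset by rewrite /d fsubsetUr.
rewrite (free_liftEw dp) (free_liftEw dq) (free_liftEw dpq).
rewrite scaler_sumr -big_split /=; apply: eq_bigr => w _.
by rewrite mcoeffD mcoeffZ scalerDl scalerA.
Qed.

Lemma free_liftU w : free_lift F << w >> = F w.
Proof.
rewrite (@free_liftEw [fset w]%fset) ?msuppU_le //.
by rewrite big_seq_fset1 mcoeffUU scale1r.
Qed.

HB.instance Definition _ :=
  GRing.isLinear.Build k {malg k[seq g]} V *:%R (free_lift F) free_lift_linear.

Hypothesis F_lin : word_multilinear F.

Lemma free_lift_rel p : lspan tens_rel p -> free_lift F p = 0.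
Proof.
apply: (@smallest_sub _ _ _ [set p | free_lift F p = 0]) => /=.
  split=> /= [|a u v u0 v0]; first by rewrite linear0.
  by rewrite linearP /= u0 v0 scaler0 addr0.
move=> _ [s1 [s2 [a [x [y ->]]]]] /=.
by rewrite linearB linearP /= !free_liftU F_lin subrr.
Qed.

Lemma tens_lift_coset p : tens_lift F (coset tens_rel p) = free_lift F p.
Proof.
rewrite /tens_lift unlock; apply/eqP.
rewrite -subr_eq0 -linearB /=; apply/eqP/free_lift_rel.
by apply/cosetP; rewrite coset_reprK.
Qed.

Lemma tens_lift_ptens w : tens_lift F (ptens w) = F w.
Proof. by rewrite tens_lift_coset free_liftU. Qed.

Lemma tens_lift_linear : linear (tens_lift F).
Proof.
move=> a t u; rewrite -[t]coset_reprK -[u]coset_reprK -linearP.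
by rewrite !tens_lift_coset linearP.
Qed.

End Lift.

Lemma ptens_multilinear : word_multilinear ptens.
Proof.
move=> s1 s2 a x y; rewrite /ptens -linearP; apply/cosetP.
by apply: sub_gen_smallest; exists s1, s2, a, x, y.
Qed.

Lemma tens_ind (P : tens -> Prop) :
  subspace (P : set tens) -> (forall w, P (ptens w)) -> forall t, P t.
Proof.
move=> [P0 PD] Pw t; rewrite -[t]coset_reprK.
move: (coset_repr t) => p; rewrite (monalgE p) linear_sum.
elim/big_ind: _ => // [u v Pu Pv|w _]; first by rewrite -[u]scale1r; apply: PD.
have ->: << p@_w *g w >> = p@_w *: << w >> :> {malg k[seq g]}.
  by apply/malgP => v; rewrite mcoeffZ !mcoeffU mulr_natr.
by rewrite linearZ /= -[_ *: _]addr0; apply: PD => //; apply: Pw.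
Qed.

Definition tmul : tens -> tens -> tens := locked_with quo_key
  (fun t u => tens_lift (fun s => tens_lift (fun w => ptens (s ++ w)) u) t).

Lemma tmulE t u :
  tmul t u = tens_lift (fun s => tens_lift (fun w => ptens (s ++ w)) u) t.
Proof. by rewrite /tmul unlock. Qed.

Lemma tmul_multilinearr s : word_multilinear (fun w => ptens (s ++ w)).
Proof. by move=> s1 s2 a x y; rewrite !catA ptens_multilinear. Qed.

Lemma tmul_multilinearl u :
  word_multilinear (fun s => tens_lift (fun w => ptens (s ++ w)) u).
Proof.
move=> s1 s2 a x y; elim/tens_ind: u => [|w].
  have L s := tens_lift_linear (@tmul_multilinearr s).
  split=> [|b u v hu hv].
    have L0 s : tens_lift (fun w => ptens (s ++ w)) 0 = 0.
      by have := L s (-1) 0 0; rewrite scaler0 addr0 scaleN1r addNr.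
    by rewrite !L0 scaler0 addr0.
  by rewrite !(L _ b u v) hu hv scale_add_swap.
rewrite !(tens_lift_ptens (@tmul_multilinearr _)) -!catA !cat_cons.
exact: ptens_multilinear.
Qed.

Lemma tmul_ptens s w : tmul (ptens s) (ptens w) = ptens (s ++ w).
Proof.
rewrite tmulE (tens_lift_ptens (@tmul_multilinearl _)).
exact: (tens_lift_ptens (@tmul_multilinearr _)).
Qed.

Lemma tmul_linearl u : linear (tmul^~ u).
Proof. by move=> a t v; rewrite /= !tmulE (tens_lift_linear (@tmul_multilinearl u)). Qed.

Lemma tmul_linearr t : linear (tmul t).
Proof.
move=> a u v; elim/tens_ind: t => [|s].
  split=> [|b t t' h h'].
    have L0 z : tmul 0 z = 0.
      by have := tmul_linearl z (-1) 0 0; rewrite scaler0 addr0 scaleN1r addNr.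
    by rewrite !L0 scaler0 addr0.
  have E z : tmul (b *: t + t') z = b *: tmul t z + tmul t' z.
    exact: tmul_linearl.
  by rewrite (E (_ + _)) (E u) (E v) h h' scale_add_swap.
rewrite !tmulE !(tens_lift_ptens (@tmul_multilinearl _)).
exact: (tens_lift_linear (@tmul_multilinearr s)).
Qed.

HB.instance Definition _ := bilinear_isBilinear.Build k tens tens tens
  *:%R *:%R tmul (tmul_linearl, tmul_linearr).

End TensorAlgebra.
Arguments tens {k} g.
Arguments tpow {k} g n.
Arguments tplus {k} g.

Section HomLie.
Variables (k : fieldType) (g : lmodType k).

Record is_hom_lie (br : {bilinear g -> g -> g}) (beta : {linear g -> g}) :
    Prop := IsHomLie {
  hom_lie_skew : forall x y, br x y = - br y x;
  hom_lie_jacobi : forall x y z,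
    br (beta x) (br y z) + br (beta y) (br z x) + br (beta z) (br x y) = 0;
  hom_lie_mult : forall x y, beta (br x y) = br (beta x) (beta y)
}.

Variables (br : {bilinear g -> g -> g}) (beta : {linear g -> g}).
Implicit Types (s w : seq g) (t u v : tens g).

Definition alphaT : tens g -> tens g := tens_lift (fun s => ptens (map beta s)).

(* hodot_word u (rev w) is u (.) ptens w; the recursion removes the last letter
   of w, which is the head of the reversed word.  The value at the empty word is
   irrelevant: only tensors in tplus are multiplied. *)
Fixpoint hodot_word (u : tens g) (rw : seq g) : tens g :=
  match rw with
  | [::] => 0
  | [:: b] => tmul u (ptens [:: b])
  | b :: rw' => tmul (hodot_word (alphaT u) rw') (alphaT (ptens [:: b]))
  end.

Definition hodot (u v : tens g) : tens g :=
  tens_lift (fun w => hodot_word u (rev w)) v.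

(* Positions in words are numbered from 1. *)
Definition twist_letter (i : nat) (x : g) : g :=
  if odd i && (3 <= i)%N then beta x else x.
Definition twist_word (s : seq g) : seq g :=
  [seq twist_letter p.1 p.2 | p <- zip (iota 1 (size s)) s].
Definition twist : tens g -> tens g := tens_lift (fun s => ptens (twist_word s)).

Definition is_hom_ideal (I : set (tens g)) : Prop :=
  [/\ subspace I, I `<=` tplus g,
      forall u v, I u -> tplus g v -> I (hodot u v) /\ I (hodot v u)
    & forall u, I u -> I (alphaT u)].

Definition hom_ideal_gen (A : set (tens g)) : set (tens g) :=
  smallest is_hom_ideal A.

Definition env_ideal : set (tens g) :=
  hom_ideal_gen [set r | exists x y : g,
    r = tmul (ptens [:: x]) (ptens [:: y]) - tmul (ptens [:: y]) (ptens [:: x])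
        - ptens [:: br x y]].

(* T^+/I, realized inside T/I as the subspace of cosets of elements of T^+. *)
Definition env_alg : set (quo env_ideal) := coset env_ideal @` tplus g.

Definition pbw_space : set (tens g) :=
  lspan [set r | exists i j (a b : tens g) (x y : g),
    [/\ tpow g i a, tpow g j b
      & r = tmul (tmul a (tmul (ptens [:: x]) (ptens [:: y])
                          - tmul (ptens [:: y]) (ptens [:: x]))) b
            - tmul (tmul (alphaT a) (ptens [:: br x y])) (alphaT b)]].

(* The tensors x_{i_1} (x) ... (x) x_{i_n}, n >= 1, with i_1 >= ... >= i_n for
   the order le on the index type. *)
Definition pbw_words (Om : choiceType) (le : rel Om) (x : Om -> g) :
    set (tens g) :=
  [set ptens (map x s) | s in
    [set s : seq Om | s != [::] /\ sorted (fun i j => le j i) s]].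

(* The lifts above are well defined and take the expected values on pure
   tensors. *)

Lemma map_beta_multilinear : word_multilinear (fun s => ptens (map beta s)).
Proof.
by move=> s1 s2 a x y; rewrite !map_cat /= linearP ptens_multilinear.
Qed.

Lemma alphaT_ptens s : alphaT (ptens s) = ptens (map beta s).
Proof. exact: (tens_lift_ptens map_beta_multilinear). Qed.

Lemma alphaT_linear : linear alphaT.
Proof. exact: (tens_lift_linear map_beta_multilinear). Qed.
HB.instance Definition _ :=
  GRing.isLinear.Build k (tens g) (tens g) *:%R alphaT alphaT_linear.

Lemma hodot_word_linearl rw a u v :
  hodot_word (a *: u + v) rw = a *: hodot_word u rw + hodot_word v rw.
Proof.
elim: rw u v => [|b [|c rw] IH] u v; first by rewrite scaler0 addr0.
  by rewrite /= linearPl.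
change (tmul (hodot_word (alphaT (a *: u + v)) (c :: rw)) (alphaT (ptens [:: b]))
  = a *: tmul (hodot_word (alphaT u) (c :: rw)) (alphaT (ptens [:: b]))
    + tmul (hodot_word (alphaT v) (c :: rw)) (alphaT (ptens [:: b]))).
by rewrite linearP IH linearPl.
Qed.

Lemma hodot_word_multilinear u : word_multilinear (hodot_word u).
Proof.
move=> s1; elim: s1 u => [|b s1 IH] u s2 a x y.
  case: s2 => [|c s2]; rewrite /=.
    rewrite -linearPr; congr (tmul _ _).
    exact: (ptens_multilinear [::] [::]).
  rewrite -linearPr -linearP; congr (tmul _ (alphaT _)).
  exact: (ptens_multilinear [::] [::]).
have E z s : hodot_word u (b :: (s1 ++ z :: s)) =
  tmul (hodot_word (alphaT u) (s1 ++ z :: s)) (alphaT (ptens [:: b])).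
  by rewrite /=; case: s1 {IH}.
by rewrite !cat_cons !E IH linearPl.
Qed.

Lemma hodot_rev_multilinear u :
  word_multilinear (fun w => hodot_word u (rev w)).
Proof.
move=> s1 s2 a x y; rewrite !rev_cat !rev_cons !cat_rcons.
exact: hodot_word_multilinear.
Qed.

Lemma hodot_linearr u : linear (hodot u).
Proof. exact: (tens_lift_linear (@hodot_rev_multilinear u)). Qed.

Lemma hodot_ptens1 u b : hodot u (ptens [:: b]) = tmul u (ptens [:: b]).
Proof. exact: (tens_lift_ptens (@hodot_rev_multilinear u)). Qed.

Lemma hodot_ptens_rcons u s b : s != [::] ->
  hodot u (ptens (rcons s b))
  = tmul (hodot (alphaT u) (ptens s)) (alphaT (ptens [:: b])).
Proof.
rewrite /hodot !(tens_lift_ptens (@hodot_rev_multilinear _)) rev_rcons.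
case/lastP: s => [//|s c] _.
by rewrite rev_rcons.
Qed.

Lemma hodot_linearl v : linear (hodot^~ v).
Proof.
move=> a t u /=; elim/tens_ind: v => [|w].
  have L0 z : hodot z 0 = 0.
    by have := hodot_linearr z (-1) 0 0; rewrite scaler0 addr0 scaleN1r addNr.
  split=> [|b v v' h h']; first by rewrite !L0 scaler0 addr0.
  have E z : hodot z (b *: v + v') = b *: hodot z v + hodot z v'.
    exact: hodot_linearr.
  by rewrite (E (_ + _)) (E t) (E u) h h' scale_add_swap.
by rewrite /hodot !(tens_lift_ptens (@hodot_rev_multilinear _)) hodot_word_linearl.
Qed.
HB.instance Definition _ := bilinear_isBilinear.Build k (tens g) (tens g) (tens g)
  *:%R *:%R hodot (hodot_linearl, hodot_linearr).

Lemma twist_word_multilinear :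
  word_multilinear (fun s => ptens (twist_word s)).
Proof.
move=> s1 s2 a x y; rewrite /twist_word !size_cat /= !iotaD /=.
rewrite !zip_cat ?size_iota // !map_cat /= /twist_letter.
by case: ifP => _; rewrite ?linearP ptens_multilinear.
Qed.

Lemma twist_ptens s : twist (ptens s) = ptens (twist_word s).
Proof. exact: (tens_lift_ptens twist_word_multilinear). Qed.

Lemma twist_linear : linear twist.
Proof. exact: (tens_lift_linear twist_word_multilinear). Qed.
HB.instance Definition _ :=
  GRing.isLinear.Build k (tens g) (tens g) *:%R twist twist_linear.

Lemma env_ideal_subspace : subspace env_ideal.
Proof. by apply: smallest_subspace => S []. Qed.

End HomLie.
Arguments env_ideal {k g} br beta.
Arguments env_alg {k g} br beta.

(* Main.v *)
Require Import Defs.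
From HB Require Import structures.
From mathcomp Require Import all_boot all_algebra sesquilinear.
From mathcomp Require Import finmap boolp classical_sets wochoice.
From mathcomp.multinomials Require Import monalg.

Set Implicit Arguments.
Unset Strict Implicit.
Unset Printing Implicit Defensive.

Import GRing.Theory.
Local Open Scope classical_set_scope.
Local Open Scope ring_scope.

(** Everything is reduced to the Poincare-Birkhoff-Witt theorem for an honest
    Lie algebra by two letterwise twists of tensors.

    Since beta is an involution, {x, y} := beta [x, y] = [beta x, beta y] is a
    Lie bracket on g of which beta is an automorphism: the Hom-Jacobi identity
    at (x, y, z) is the Jacobi identity of {_, _}, because
    {x, {y, z}} = [beta x, [y, z]].  Let L be the span of the tensors
    a (x y - y x - {x, y}) b.  Let psi act on degree n as alpha_T^(n-1), and
    let phi be the twist operator; both are involutions and they commute.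

    - psi exchanges J and L.  The leading part of a relator of J has degree
      n = i + j + 2 and its correction is alpha_T (a {x, y} b), of degree n - 1,
      so that psi applies alpha_T^(n-1) to a (x y - y x) b as well as to
      a {x, y} b; this is a relator of L, since beta preserves the bracket.
    - Phi := psi phi exchanges I and L.  Counting how often beta hits each
      letter gives Phi (u (.) v) = alpha_T (Phi u (x) Phi v), so that Phi turns
      Hom-ideals into the two-sided ideals of the tensor algebra that are stable
      under alpha_T, and it sends x y - y x - [x, y] to the relator of L at
      beta x, beta y.

    Hence phi (I) = J.  As the characteristic is not 2, g is spanned by
    eigenvectors of beta; a basis X of eigenvectors makes psi rescale every word
    in X, so psi preserves the span of W.  Both statements thus follow from
    T^+ = L (+) kW and the independence of W, which is lie_pbw.

    For lie_pbw, sorting the letters of a word modulo L and shorter words shows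
    that L and W span T^+.  For the converse, g acts on the free module on the
    non-increasing words in X in such a way that a letter not smaller than
    those of a word is just put in front of it (pbw_action_exists).  That this
    is an action of the Lie algebra (defect_filt) is an induction on length in
    which the Jacobi identity enters once (defect_rho).  Acting on the empty
    word is a linear map on tensors that kills L and sends the elements of W to
    distinct basis vectors. *)

(** * Subspaces, spans and bases *)

Section Subspaces.
Variables (k : fieldType) (V : lmodType k).
Implicit Types (S A B : set V) (u v : V).

Lemma subspaceZ S a v : subspace S -> S v -> S (a *: v).
Proof. by move=> [S0 SP] Sv; rewrite -[_ *: _]addr0; apply: SP. Qed.

Lemma subspaceD S u v : subspace S -> S u -> S v -> S (u + v).
Proof. by move=> [S0 SP] Su Sv; rewrite -[u]scale1r; apply: SP. Qed.

Lemma subspaceN S v : subspace S -> S v -> S (- v).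
Proof. by move=> SS Sv; rewrite -scaleN1r; apply: subspaceZ. Qed.

Lemma subspaceB S u v : subspace S -> S u -> S v -> S (u - v).
Proof. by move=> SS Su Sv; apply: subspaceD => //; apply: subspaceN. Qed.

Lemma subspace_sum S (I : eqType) (s : seq I) (F : I -> V) :
  subspace S -> {in s, forall i, S (F i)} -> S (\sum_(i <- s) F i).
Proof.
move=> SS SF; rewrite big_seq; elim/big_ind: _ => //; first by case: SS.
by move=> u v; apply: subspaceD.
Qed.

Lemma mem_lspan A v : A v -> lspan A v.
Proof. exact: sub_gen_smallest. Qed.

Lemma lspan_sub A S : subspace S -> A `<=` S -> lspan A `<=` S.
Proof. exact: smallest_sub. Qed.

Lemma lspan_le A B : A `<=` B -> lspan A `<=` lspan B.
Proof.
move=> AB; apply: lspan_sub => [|v Av]; first exact: lspan_subspace.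
by apply: mem_lspan; apply: AB.
Qed.

Section Linear.
Variables (W : lmodType k) (f : V -> W).
Hypothesis f_lin : linear f.

Lemma linear_zero : f 0 = 0.
Proof. by have := f_lin (-1) 0 0; rewrite scaler0 addr0 scaleN1r addNr. Qed.

Lemma linear_add u v : f (u + v) = f u + f v.
Proof. by have := f_lin 1 u v; rewrite !scale1r. Qed.

Lemma linear_combination (s : seq V) (c : V -> k) :
  f (\sum_(v <- s) c v *: v) = \sum_(v <- s) c v *: f v.
Proof.
by elim: s => [|v s IH]; rewrite ?big_nil ?linear_zero // !big_cons f_lin IH.
Qed.

Lemma subspace_preim (S : set W) : subspace S -> subspace (f @^-1` S).
Proof.
move=> [S0 SP]; split=> [|a u v Su Sv] /=; first by rewrite linear_zero.
by rewrite f_lin; apply: SP.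
Qed.

Lemma subspace_linear_eq0 : subspace [set u | f u = 0].
Proof.
split=> [|a u v /= u0 v0]; first exact: linear_zero.
by rewrite f_lin u0 v0 scaler0 addr0.
Qed.

Lemma lspan_linear A (S : set W) :
  subspace S -> (forall v, A v -> S (f v)) -> forall v, lspan A v -> S (f v).
Proof. by move=> SS AS v Av; apply: (lspan_sub (subspace_preim SS) AS). Qed.

Lemma subspace_image A : subspace A -> subspace (f @` A).
Proof.
move=> [A0 AP]; split=> [|a _ _ [u Au <-] [v Av <-]].
  by exists 0; rewrite ?linear_zero.
by exists (a *: u + v); [exact: AP | rewrite f_lin].
Qed.

End Linear.

Lemma linear_comp (U W : lmodType k) (f : V -> U) (h : U -> W) :
  linear f -> linear h -> linear (fun u => h (f u)).
Proof. by move=> Lf Lh a u v; rewrite Lf Lh. Qed.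

Lemma linear_sub (W : lmodType k) (f h : V -> W) :
  linear f -> linear h -> linear (fun u => f u - h u).
Proof.
move=> Lf Lh a u v; rewrite Lf Lh scalerBr opprD.
exact: addrACA.
Qed.

Lemma subspace_plus A B :
  subspace A -> subspace B -> subspace [set a + b | a in A & b in B].
Proof.
move=> [A0 AP] [B0 BP]; split; first by exists 0 => //; exists 0; rewrite ?addr0.
move=> c _ _ [a1 Aa1 [b1 Bb1 <-]] [a2 Aa2 [b2 Bb2 <-]].
exists (c *: a1 + a2); first exact: AP.
by exists (c *: b1 + b2); [exact: BP | rewrite scalerDr addrACA].
Qed.

Definition free_set A : Prop := forall (s : seq V) (c : V -> k),
  uniq s -> {in s, forall v, A v} -> \sum_(v <- s) c v *: v = 0 ->
  {in s, forall v, c v = 0}.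

(** A dependency involves finitely many vectors, and these lie in one member of
    the chain. *)
Lemma free_bigcup (F : set (set V)) :
  (forall A, F A -> free_set A) -> total_on F subset ->
  free_set (\bigcup_(A in F) A).
Proof.
move=> freeF totF s c us sF.
have [->//|[A FA sA]] : s = [::] \/ exists2 A, F A & {in s, forall v, A v}.
  elim: s {us} sF => [|v s IH] sF; [by left | right].
  have [A FA Av] := sF v (mem_head _ _).
  have [w ws|->|[B FB sB]] := IH; first by apply: sF; rewrite in_cons ws orbT.
    by exists A => // w; rewrite inE => /eqP->.
  have [AB|BA] := totF A B FA FB.
    by exists B => // w; rewrite inE => /orP[/eqP->|/sB//]; apply: AB.
  by exists A => // w; rewrite inE => /orP[/eqP->//|/sB]; apply: BA.
exact: (freeF A FA).
Qed.

(** In a dependency on A and v, the coefficient of v vanishes, as v would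
    otherwise be a combination of A. *)
Lemma free_setU1 A v : free_set A -> ~ lspan A v -> free_set (A `|` [set v]).
Proof.
move=> freeA Av s c us sAv sum0.
have rest w : w \in s -> w != v -> A w by move=> /sAv[//|->]; rewrite eqxx.
have [vs|vNs] := boolP (v \in s); last first.
  apply: freeA => // w ws; apply: rest => //.
  by apply: contraNneq vNs => <-.
have uv : uniq (rem v s) by rewrite rem_uniq.
have sA : {in rem v s, forall w, A w}.
  by move=> w; rewrite mem_rem_uniq // inE => /andP[wv ws]; apply: rest.
have E : c v *: v + \sum_(w <- rem v s) c w *: w = 0.
  by rewrite -[RHS]sum0 [RHS](perm_big _ (perm_to_rem vs)) big_cons.
have cv0 : c v = 0.
  apply: contrapT => /eqP cv; apply: Av.
  have -> : v = (c v)^-1 *: - \sum_(w <- rem v s) c w *: w.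
    by rewrite -(addr0_eq E) opprK scalerA mulVf // scale1r.
  have SA := lspan_subspace A.
  apply: (subspaceZ _ SA); apply: (subspaceN SA).
  apply: (subspace_sum SA) => w /sA Aw.
  by apply: (subspaceZ _ SA); apply: mem_lspan.
move=> w ws; have [->//|wv] := eqVneq w v.
apply: (freeA (rem v s)) => //; last by rewrite mem_rem_uniq // inE wv.
by move: E; rewrite cv0 scale0r add0r.
Qed.

(** By Zorn's lemma there is a maximal free subset of A; a vector of A outside
    of its span could be added to it. *)
Lemma free_subset_spanning A :
  exists B, [/\ B `<=` A, free_set B & lspan B = lspan A].
Proof.
have [F FP totF|B [[BA freeB] maxB]] :=
    @Zorn_bigcup V [set B | B `<=` A /\ free_set B].
  split; first by move=> v [X /FP[XA _] /XA].
  by apply: free_bigcup => // X /FP[].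
exists B; split=> //; apply/seteqP; split; first exact: lspan_le.
apply: lspan_sub; first exact: lspan_subspace.
move=> v Av; apply: contrapT => Bv; apply: (maxB (B `|` [set v])).
  split=> [|/(_ v (or_intror erefl)) Bv']; first exact: subsetUl.
  by apply: Bv; apply: mem_lspan.
by split; [move=> w [/BA//|->] | exact: free_setU1].
Qed.

Lemma free_set_basis B : free_set B -> lspan B = setT ->
  is_basis setT (fun i : {v : V | v \in B} => sval i) setT.
Proof.
move=> freeB spanB; split=> [s c us _ sum0 i si|]; last first.
  rewrite -spanB; congr lspan; apply/seteqP; split=> [_ [[v Bv] _ <-]|v Bv].
    exact: set_mem.
  by exists (exist _ v (mem_set Bv)).
pose c' v := odflt 0 (omap c (insub v)).
have c'E j : c' (sval j) = c j by rewrite /c' (valK j).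
rewrite -c'E; apply: (freeB (map sval s)); last exact: map_f.
- by rewrite map_inj_uniq //; exact: val_inj.
- by move=> _ /mapP[j _ ->]; apply: set_mem; case: j.
by rewrite big_map -[RHS]sum0; apply: eq_bigr => j _; rewrite c'E.
Qed.

End Subspaces.

(** As 2 is invertible, v = (v + f v) / 2 + (v - f v) / 2 is a sum of
    eigenvectors, so a basis can be chosen among the eigenvectors.  Any
    well-order of it will do. *)
Lemma involution_eigenbasis (k : fieldType) (V : lmodType k)
    (f : {linear V -> V}) : 2%N \notin [pchar k] -> involutive f ->
  exists (Om : choiceType) (le : rel Om) (x : Om -> V),
    [/\ well_order le, is_basis setT x setT
      & forall i, f (x i) = x i \/ f (x i) = - x i].
Proof.
move=> char2 ff.
have two : 2%:R != 0 :> k by move: char2; rewrite !inE.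
pose E : set V := [set v | f v = v \/ f v = - v].
have spanE : lspan E = setT.
  apply/seteqP; split=> // v _.
  have -> : v = 2%:R^-1 *: (v + f v) + 2%:R^-1 *: (v - f v).
    rewrite -scalerDr addrACA subrr addr0 -mulr2n -scaler_nat scalerA.
    by rewrite mulVf // scale1r.
  have SE := lspan_subspace E.
  apply: (subspaceD SE); apply: (subspaceZ _ SE); apply: mem_lspan.
    by left; rewrite linearD ff addrC.
  by right; rewrite linearB ff opprB.
have [B [BE freeB spanB]] := free_subset_spanning E.
have [le le_wo] := well_ordering_principle {v : V | v \in B}.
exists {v : V | v \in B}, le, (fun i => sval i); split=> //.
  by apply: free_set_basis; rewrite ?spanB.
by move=> i; apply/BE/set_mem; case: i.
Qed.

(** * Linear extension from a basis *)

Section FreeModules.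
Variables (k : fieldType) (I : choiceType) (V : lmodType k).
Implicit Types (f h : I -> V) (p q : {malg k[I]}).

(** Locking keeps conversion tests away from finite supports. *)
Definition malg_lift f p : V :=
  locked_with quo_key (\sum_(i <- msupp p) p@_i *: f i).

Lemma malg_liftE f p : malg_lift f p = \sum_(i <- msupp p) p@_i *: f i.
Proof. by rewrite /malg_lift unlock. Qed.

Lemma eq_malg_lift f h p : f =1 h -> malg_lift f p = malg_lift h p.
Proof. by move=> fh; rewrite !malg_liftE; apply: eq_bigr => i _; rewrite fh. Qed.

Lemma subspace_malg_lift (S : set V) f p :
  subspace S -> (forall i, S (f i)) -> S (malg_lift f p).
Proof.
move=> SS Sf; rewrite malg_liftE; apply: (subspace_sum SS) => i _.
exact: (subspaceZ _ SS).
Qed.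

(** Linearity compares sums over different supports, hence this enlargement of
    the range of summation. *)
Lemma malg_liftEw f (d : {fset I}) p :
  (msupp p `<=` d)%fset -> malg_lift f p = \sum_(i <- d) p@_i *: f i.
Proof.
move=> le_pd; rewrite malg_liftE (big_fset_incl _ le_pd) // => i _ iNp.
by rewrite mcoeff_outdom // scale0r.
Qed.

Lemma malg_lift_linear f : linear (malg_lift f).
Proof.
move=> a p q; set d := (msupp p `|` msupp q `|` msupp (a *: p + q))%fset.
have dp : (msupp p `<=` d)%fset by rewrite /d -fsetUA fsubsetUl.
have dq : (msupp q `<=` d)%fset by rewrite /d fsetUAC fsubsetUr.
have dpq : (msupp (a *: p + q) `<=` d)%fset by rewrite /d fsubsetUr.
rewrite (malg_liftEw f dp) (malg_liftEw f dq) (malg_liftEw f dpq).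
rewrite scaler_sumr -big_split /=; apply: eq_bigr => i _.
by rewrite mcoeffD mcoeffZ scalerDl scalerA.
Qed.
HB.instance Definition _ f :=
  GRing.isLinear.Build k {malg k[I]} V *:%R (malg_lift f) (malg_lift_linear f).

Lemma malg_liftU f i : malg_lift f << i >> = f i.
Proof.
rewrite (@malg_liftEw f [fset i]%fset) ?msuppU_le //.
by rewrite big_seq_fset1 mcoeffUU scale1r.
Qed.

Lemma malg_lift_fun_linear f h a p :
  malg_lift (fun i => a *: f i + h i) p = a *: malg_lift f p + malg_lift h p.
Proof.
rewrite !malg_liftE scaler_sumr -big_split /=; apply: eq_bigr => i _.
by rewrite scalerDr !scalerA mulrC.
Qed.

Variable x : I -> V.
Hypothesis x_basis : is_basis setT x setT.

Lemma basis_ind (P : V -> Prop) :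
  subspace (P : set V) -> (forall i, P (x i)) -> forall v, P v.
Proof.
move=> SP Px v; have : lspan (x @` setT) v by rewrite x_basis.2.
by apply: lspan_sub => // _ [i _ <-].
Qed.

Lemma coord_exists v : exists p, malg_lift x p = v.
Proof.
elim/basis_ind: v => [|i]; last by exists << i >>; rewrite malg_liftU.
split=> [|a _ _ [p <-] [q <-]]; first by exists 0; rewrite linear0.
by exists (a *: p + q); rewrite linearP.
Qed.

Definition basis_coord v : {malg k[I]} := sval (cid (coord_exists v)).

Lemma malg_lift_basis_coord v : malg_lift x (basis_coord v) = v.
Proof. by rewrite /basis_coord; case: cid. Qed.

Lemma malg_lift_inj : injective (malg_lift x).
Proof.
move=> p q /eqP; rewrite -subr_eq0 -linearB /=; set r := p - q => /eqP r0.
suff: r = 0 by move/eqP; rewrite subr_eq0 => /eqP.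
apply/malgP => i; rewrite mcoeff0.
have [ir|/mcoeff_outdom//] := boolP (i \in msupp r).
move: r0; rewrite malg_liftE => r0.
exact: (x_basis.1 (msupp r) (fun i => r@_i) (fset_uniq _)).
Qed.

Lemma basis_coordK p : basis_coord (malg_lift x p) = p.
Proof. by apply: malg_lift_inj; rewrite malg_lift_basis_coord. Qed.

Lemma basis_coord_linear : linear basis_coord.
Proof.
move=> a u v; apply: malg_lift_inj.
by rewrite linearP /= !malg_lift_basis_coord.
Qed.
HB.instance Definition _ :=
  GRing.isLinear.Build k V {malg k[I]} *:%R basis_coord basis_coord_linear.

Lemma basis_coord_basis i : basis_coord (x i) = << i >>.
Proof. by rewrite -[x i](malg_liftU x) basis_coordK. Qed.

End FreeModules.

(** * Lie algebra actions on non-increasing words *)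

Section LieIdeal.
Variables (k : fieldType) (g : lmodType k) (lb : {bilinear g -> g -> g}).

Definition lie_relator (a b : seq g) (y z : g) : tens g :=
  ptens (a ++ y :: z :: b) - ptens (a ++ z :: y :: b) - ptens (a ++ lb y z :: b).

Definition lie_ideal : set (tens g) :=
  lspan [set r | exists a b y z, r = lie_relator a b y z].

Lemma lie_ideal_subspace : subspace lie_ideal.
Proof. exact: lspan_subspace. Qed.

Lemma mem_lie_ideal a b y z : lie_ideal (lie_relator a b y z).
Proof. by apply: mem_lspan; exists a, b, y, z. Qed.

End LieIdeal.

Section OrderedWords.
Variables (Om : choiceType) (le : rel Om).
Hypothesis le_anti : antisymmetric le.
Hypothesis le_trans : transitive le.
Hypothesis le_total : total le.

Let ge : rel Om := fun i j => le j i.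
Implicit Types (i j l : Om) (s t : seq Om).

Lemma lt_le i j : ~~ le j i -> le i j.
Proof. by have /orP[->//|->] := le_total i j. Qed.

Fixpoint insert i s : seq Om :=
  if s is j :: s' then if le j i then i :: s else j :: insert i s' else [:: i].

Lemma size_insert i s : size (insert i s) = (size s).+1.
Proof. by elim: s => //= j s IH; case: ifP => //= _; rewrite IH. Qed.

Lemma path_insert l i s : path ge l s -> le i l -> path ge l (insert i s).
Proof.
elim: s l => [|j s IH] l /=; first by rewrite /ge => _ ->.
case/andP=> lj js il; case: ifPn => [ji|/lt_le ij] /=; last by rewrite lj IH.
by rewrite /ge il ji.
Qed.

Lemma sorted_insert i s : sorted ge s -> sorted ge (insert i s).
Proof.
case: s => //= j s js; case: ifPn => [ji|/lt_le ij] /=; last exact: path_insert.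
by rewrite /ge ji.
Qed.

Lemma insert_path i s : path ge i s -> insert i s = i :: s.
Proof. by case: s => //= j s /andP[ji _]; rewrite ifT. Qed.

Lemma path_ge l i s : path ge i s -> le i l -> path ge l s.
Proof.
case: s => //= j s /andP[ij js] il; rewrite js andbT.
exact: le_trans ij il.
Qed.

Section Filtration.
Variables (k : fieldType) (V : lmodType k) (z : seq Om -> V).

(** For z the map to basis vectors, this is the filtration by length of the
    module on non-increasing words. *)
Definition word_filt n : set V :=
  lspan [set z s | s in [set s | sorted ge s /\ (size s <= n)%N]].

Lemma word_filt_subspace n : subspace (word_filt n).
Proof. exact: lspan_subspace. Qed.

Lemma mem_word_filt n s : sorted ge s -> (size s <= n)%N -> word_filt n (z s).
Proof. by move=> ss sn; apply: mem_lspan; exists s. Qed.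

Lemma word_filt_le m n p : (m <= n)%N -> word_filt m p -> word_filt n p.
Proof.
move=> mn; apply: lspan_le => _ [s [ss sm] <-]; exists s => //.
by split=> //; apply: leq_trans mn.
Qed.

Lemma word_filt_ind n (P : V -> Prop) : subspace (P : set V) ->
  (forall s, sorted ge s -> (size s <= n)%N -> P (z s)) ->
  forall p, word_filt n p -> P p.
Proof. by move=> SP Ps p; apply: lspan_sub => // _ [s [ss sn] <-]; apply: Ps. Qed.

End Filtration.

Section LieAction.
Variables (k : fieldType) (g : lmodType k) (lb : {bilinear g -> g -> g}).
Hypothesis lbxx : forall y, lb y y = 0.
Hypothesis jacobi : forall y w t : g,
  lb y (lb w t) + lb w (lb t y) + lb t (lb y w) = 0.
Variable x : Om -> g.
Hypothesis x_basis : is_basis setT x setT.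
Variables (V : lmodType k) (rho : {bilinear g -> V -> V}).
Implicit Types (y w : g) (p q : V).

Lemma lb_skew y w : lb y w = - lb w y.
Proof.
apply/eqP; rewrite -addr_eq0; have := lbxx (y + w).
by rewrite linearDl !linearDr !lbxx add0r addr0 /= addrC => ->.
Qed.

(** The failure of rho to be an action of the Lie algebra g on V. *)
Definition defect y w p : V := rho y (rho w p) - rho w (rho y p) - rho (lb y w) p.

Lemma scale_add_sub (W : lmodType k) a (A B C A' B' C' : W) :
  (a *: A + A') - (a *: B + B') - (a *: C + C')
  = a *: (A - B - C) + (A' - B' - C').
Proof.
by rewrite !scalerBr !opprD (addrACA (a *: A)) (addrACA (a *: A - a *: B)).
Qed.

Lemma defect_linear1 w p : linear (fun y => defect y w p).
Proof.
move=> a y y' /=; rewrite /defect linearPl (linearPl rho) (linearPl lb).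
by rewrite (linearPl rho) linearPr scale_add_sub.
Qed.

Lemma defect_linear3 y w : linear (defect y w).
Proof.
move=> a p q; rewrite /defect !(linearPr rho).
by rewrite scale_add_sub.
Qed.

Lemma defect_skew y w p : defect y w p = - defect w y p.
Proof. by rewrite /defect lb_skew linearNl /= opprK !opprB addrC. Qed.

Lemma defect_basis p :
  (forall i j, defect (x i) (x j) p = 0) -> forall y w, defect y w p = 0.
Proof.
move=> Dij y w; elim/(basis_ind x_basis): y => [|i].
  exact: subspace_linear_eq0 (defect_linear1 w p).
rewrite defect_skew; apply/eqP; rewrite oppr_eq0; apply/eqP.
elim/(basis_ind x_basis): w => [|j]; last exact: Dij.
exact: subspace_linear_eq0 (defect_linear1 (x i) p).
Qed.

Lemma defect_eq0 y w p :
  defect y w p = 0 -> rho y (rho w p) = rho w (rho y p) + rho (lb y w) p.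
Proof. by move/eqP; rewrite subr_eq0 subr_eq addrC => /eqP. Qed.

(** The only place where the Jacobi identity is used.  Pulling rho t to the left
    of rho y and rho w is allowed by the hypotheses; the mixed terms
    rho [y, t] rho w and rho [w, t] rho y cancel in the commutator, and what
    remains is rho of a Jacobi sum. *)
Lemma defect_rho y w (t : g) u :
  (forall y' w', defect y' w' u = 0) ->
  defect y t (rho w u) = 0 -> defect w t (rho y u) = 0 ->
  defect y w (rho t u) = 0.
Proof.
move=> Du Dyt Dwt.
have R y' w' := defect_eq0 (Du y' w').
have E1 : rho y (rho w (rho t u)) = rho t (rho y (rho w u)) + rho (lb y t) (rho w u)
    + (rho (lb w t) (rho y u) + rho (lb y (lb w t)) u).
  by rewrite (R w t) linearDr /= (defect_eq0 Dyt) (R y (lb w t)).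
have E2 : rho w (rho y (rho t u)) = rho t (rho w (rho y u)) + rho (lb w t) (rho y u)
    + (rho (lb y t) (rho w u) + rho (lb w (lb y t)) u).
  by rewrite (R y t) linearDr /= (defect_eq0 Dwt) (R w (lb y t)).
have E3 : rho t (rho y (rho w u)) = rho t (rho w (rho y u)) + rho t (rho (lb y w) u).
  by rewrite (R y w) linearDr.
rewrite /defect E1 E2 E3 (R t (lb y w)).
set A := rho t _; set B := rho (lb y w) _; set C := rho (lb y t) _.
set D := rho (lb w t) _.
have J : rho (lb t (lb y w)) u + rho (lb y (lb w t)) u = rho (lb w (lb y t)) u.
  apply/eqP; rewrite -subr_eq0 -linearDl -linearBl /=.
  rewrite (lb_skew y t) linearNr /= opprK [lb t _ + _]addrC addrAC jacobi.
  by rewrite linear0l.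
rewrite -J.
set X := rho _ u; set Y := rho _ u.
(* The six terms left are equal up to their order. *)
apply/eqP; rewrite subr_eq0 subr_eq; apply/eqP.
by rewrite !addrA [LHS](ACl (2*1*5*4*3*6)).
Qed.

(* The three properties of the action that are needed: big letters are put in
   front, any letter acts as insertion up to shorter words, and letters commute
   up to the bracket if the bigger one can be put in front. *)
Variable z : seq Om -> V.
Hypothesis rho_path : forall i s, path ge i s -> rho (x i) (z s) = z (i :: s).
Hypothesis rho_insert : forall i s, sorted ge s ->
  word_filt z (size s) (rho (x i) (z s) - z (insert i s)).
Hypothesis rho_cons : forall i j s, path ge j s -> ~~ le j i ->
  rho (x i) (z (j :: s))
  = rho (x j) (rho (x i) (z s)) + rho (lb (x i) (x j)) (z s).

(** If i can be put in front of s, then so can the bigger one of i and j, and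
    rho_cons applies to the two letters in the right order. *)
Lemma defect_path i j s : path ge i s -> defect (x i) (x j) (z s) = 0.
Proof.
have lt i' j' : path ge j' s -> ~~ le j' i' -> defect (x i') (x j') (z s) = 0.
  move=> js ij; rewrite /defect (rho_path js) (rho_cons js ij).
  by rewrite [X in X - _ - _]addrC addrK subrr.
move=> si; have [->|nij] := eqVneq i j.
  by rewrite /defect lbxx linear0l subrr subr0.
have [ji|ij] := boolP (le j i); last first.
  by apply: lt => //; apply: path_ge si _; apply: lt_le.
rewrite defect_skew lt ?oppr0 //; apply: contraNN nij => ij.
by apply/eqP/le_anti; rewrite ij.
Qed.

(** By induction on length.  For a word l :: s with l bigger than both letters,
    l :: s is x l applied to s, and defect_rho reduces the claim to words to
    which x j' has been applied.  Up to shorter words these are the words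
    insert j' s, in front of which l can be put. *)
Lemma defect_filt n p y w : word_filt z n p -> defect y w p = 0.
Proof.
move=> pn; elim: n p pn y w => [|n IH] p pn.
  apply: defect_basis => i j; move: p pn; apply: word_filt_ind.
    exact: subspace_linear_eq0 (defect_linear3 _ _).
  by case=> // _ _; apply: defect_path.
apply: defect_basis => i j; move: p pn; apply: word_filt_ind.
  exact: subspace_linear_eq0 (defect_linear3 _ _).
case=> [_ _|l s ls sn]; first exact: defect_path.
have [li|il] := boolP (le l i); first by apply: defect_path; rewrite /= /ge li.
have [lj|jl] := boolP (le l j).
  by rewrite defect_skew defect_path ?oppr0 //= /ge lj.
have ss : sorted ge s := path_sorted ls.
have us : word_filt z n (z s) by apply: mem_word_filt.
have step i' j' : ~~ le l j' -> defect (x i') (x l) (rho (x j') (z s)) = 0.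
  move=> j'l; rewrite -[rho _ _](subrK (z (insert j' s))).
  have S := subspace_linear_eq0 (defect_linear3 (x i') (x l)).
  apply: (subspaceD S) => /=.
    by apply: IH; apply: word_filt_le (rho_insert j' ss).
  rewrite defect_skew defect_path ?oppr0 //.
  by apply: path_insert => //; apply: lt_le.
rewrite -(rho_path ls); apply: defect_rho; [|exact: step|exact: step].
by move=> y' w'; apply: IH.
Qed.

Lemma filt_rho n y p : word_filt z n p -> word_filt z n.+1 (rho y p).
Proof.
have S := @word_filt_subspace k V z n.+1.
move=> pn; elim/(basis_ind x_basis): y => [|i].
  split=> [|a u v hu hv]; first by rewrite linear0l; have [] := S.
  by rewrite linearPl; apply: S.2.
move: p pn; apply: word_filt_ind => [|s ss sn].
  split=> [|a u v hu hv]; first by rewrite linear0r; have [] := S.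
  by rewrite linearPr; apply: S.2.
rewrite -[rho _ _](subrK (z (insert i s))); apply: (subspaceD S).
  by apply: word_filt_le (rho_insert i ss); apply: leqW.
by apply: mem_word_filt; [exact: sorted_insert | rewrite size_insert].
Qed.

(** The action of a word over g on the empty word; it is multilinear in the
    letters, so it descends to tensors without choosing bases. *)
Definition word_act (s : seq g) : V := foldr rho (z [::]) s.

Lemma word_act_multilinear : word_multilinear word_act.
Proof.
move=> s1 s2 a y w; rewrite /word_act; elim: s1 => [|c s1 IH] /=.
  by rewrite linearPl.
by rewrite IH linearPr.
Qed.

Lemma filt_word_act (s : seq g) : word_filt z (size s) (word_act s).
Proof. by elim: s => [|y s IH] /=; [apply: mem_word_filt | apply: filt_rho]. Qed.

Lemma word_act_sorted s : sorted ge s -> word_act (map x s) = z s.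
Proof.
rewrite /word_act; elim: s => [//|i s IH] si.
by rewrite /= -/word_act IH ?rho_path //; apply: path_sorted si.
Qed.

Definition normal_form : tens g -> V := tens_lift word_act.

Lemma normal_form_linear : linear normal_form.
Proof. exact: tens_lift_linear word_act_multilinear. Qed.
HB.instance Definition _ :=
  GRing.isLinear.Build k (tens g) V *:%R normal_form normal_form_linear.

Lemma normal_form_ptens (s : seq g) : normal_form (ptens s) = word_act s.
Proof. exact: tens_lift_ptens word_act_multilinear s. Qed.

(** The letters behind a relator produce a vector of the filtration, where the
    defect vanishes. *)
Lemma normal_form_lie_ideal (t : tens g) : lie_ideal lb t -> normal_form t = 0.
Proof.
move: t; apply: (@lspan_sub _ _ _ [set t | normal_form t = 0]).
  exact: subspace_linear_eq0 normal_form_linear.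
move=> _ [a [b [y [w ->]]]] /=; rewrite /lie_relator !linearB /= !normal_form_ptens.
have := defect_filt y w (@filt_word_act b); rewrite /defect /word_act.
rewrite !foldr_cat /=; elim: a => //= c a IH D.
by rewrite -!linearBr /= IH // linear0r.
Qed.

End LieAction.
End OrderedWords.

(** * Construction of the action *)

Section LieActionConstruction.
Variables (k : fieldType) (g : lmodType k) (lb : {bilinear g -> g -> g}).
Variables (Om : choiceType) (le : rel Om) (x : Om -> g).
Hypothesis le_total : total le.
Hypothesis x_basis : is_basis setT x setT.

Local Notation coord := (basis_coord x_basis).
Let ge : rel Om := fun i j => le j i.
Local Notation V := {malg k[seq Om]}.
Implicit Types (i j l : Om) (s t : seq Om) (y z : g) (p q : V).

Local Notation filt := (word_filt le (fun s => << s >> : V)).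

Lemma filt0 n : filt n 0.
Proof. by have [] := @word_filt_subspace _ le _ _ (fun s => << s >> : V) n. Qed.

Lemma filt_lift (f : seq Om -> V) m n p :
  (forall s, sorted ge s -> (size s <= m)%N -> filt n (f s)) ->
  filt m p -> filt n (malg_lift f p).
Proof.
move=> fmn; move: p; apply: word_filt_ind => [|s ss sm]; last first.
  by rewrite malg_liftU; apply: fmn.
exact: (subspace_preim (malg_lift_linear f) (word_filt_subspace _ _ _)).
Qed.

Lemma eq_filt_lift (f h : seq Om -> V) m p :
  (forall s, sorted ge s -> (size s <= m)%N -> f s = h s) ->
  filt m p -> malg_lift f p = malg_lift h p.
Proof.
move=> fh; move: p; apply: word_filt_ind => [|s ss sm]; last first.
  by rewrite !malg_liftU fh.
split=> [|a u v hu hv]; first by rewrite !linear0.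
by rewrite !linearP /= hu hv.
Qed.

(** The action of x i on a word is insertion plus a correction low i s made of
    words not longer than s. *)
Definition act_with (low : Om -> seq Om -> V) i s : V := << insert le i s >> + low i s.

(** For i < j, the commutation rule
    x i (j :: s) = x j (x i s) + [x i, x j] s and the fact that
    x j (insert i s) = j :: insert i s determine the correction for j :: s from
    the actions on words of length at most that of s. *)
Definition low_step (low : Om -> seq Om -> V) i s : V :=
  if s is j :: s' then
    if le j i then 0
    else malg_lift (act_with low j) (low i s')
         + malg_lift (act_with low ^~ s') (coord (lb (x i) (x j)))
  else 0.

Lemma filt_act_with (low : Om -> seq Om -> V) n i s : sorted ge s ->
  (size s <= n)%N -> filt (size s) (low i s) -> filt n.+1 (act_with low i s).
Proof.
move=> ss sn Flow; apply: (subspaceD (word_filt_subspace _ _ _)).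
  by apply: mem_word_filt; [exact: sorted_insert | rewrite size_insert].
exact: word_filt_le (leqW sn) Flow.
Qed.

(* The recursion for the correction is not structural: x j acts on the words
   occurring in low i s.  Since these words are not longer than s, n rounds of
   the recursion determine the corrections for words of length at most n.  L n
   stands for the outcome of n rounds, known through its equations only. *)
Section Stabilization.
Variable L : nat -> Om -> seq Om -> V.
Hypothesis L_path : forall n i s, path ge i s -> L n i s = 0.
Hypothesis L_cons : forall n i j s, ~~ le j i -> L n.+1 i (j :: s) =
  malg_lift (act_with (L n) j) (L n i s)
  + malg_lift (act_with (L n) ^~ s) (coord (lb (x i) (x j))).

Lemma approx_stable n i s : sorted ge s -> (size s <= n)%N ->
  filt (size s) (L n i s) /\ L n.+1 i s = L n i s.
Proof.
elim: n i s => [|n IH] i [|j s] js sn; try by [].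
- by rewrite !L_path //; split; first exact: filt0.
- by rewrite !L_path //; split; first exact: filt0.
have [ji|ij] := boolP (le j i).
  have ijs : path ge i (j :: s) by rewrite /= /ge ji.
  by rewrite !L_path //; split; first exact: filt0.
have ss : sorted ge s := path_sorted js.
have [low_s low_sE] := IH i s ss sn.
have act_filt l t : sorted ge t -> (size t <= size s)%N ->
    filt (size s).+1 (act_with (L n) l t).
  move=> st ts; apply: (filt_act_with st ts).
  by have [] := IH l t st (leq_trans ts sn).
have act_eq l t : sorted ge t -> (size t <= size s)%N ->
    act_with (L n.+1) l t = act_with (L n) l t.
  move=> st ts; rewrite /act_with.
  by have [_ ->] := IH l t st (leq_trans ts sn).
rewrite (L_cons n s ij) (L_cons n.+1 s ij) low_sE; split.
  apply: (subspaceD (word_filt_subspace _ _ _)).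
    by apply: filt_lift low_s => t; apply: act_filt.
  by apply: (subspace_malg_lift _ (word_filt_subspace _ _ _)) => l; apply: act_filt.
rewrite (eq_filt_lift (act_eq j) low_s).
by rewrite (eq_malg_lift _ (fun l => act_eq l s ss (leqnn _))).
Qed.

Lemma approxE n i s : sorted ge s -> (size s <= n)%N -> L n i s = L (size s) i s.
Proof.
move=> ss /subnK <-; elim: (n - size s)%N => [|m IH]; first by [].
rewrite addSn -[RHS]IH.
by have [] := @approx_stable (m + size s) i s ss (leq_addl _ _).
Qed.

Lemma approx_diag_cons i j s : path ge j s -> ~~ le j i ->
  L (size s).+1 i (j :: s) =
    malg_lift (act_with (fun l t => L (size t) l t) j) (L (size s) i s)
    + malg_lift (act_with (fun l t => L (size t) l t) ^~ s)
        (coord (lb (x i) (x j))).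
Proof.
move=> js ij; have ss := path_sorted js; rewrite (L_cons _ s ij).
have [low_s _] := approx_stable i ss (leqnn _).
rewrite (eq_filt_lift (h := act_with (fun l t => L (size t) l t) j) _ low_s) //.
by move=> t st ts; rewrite /act_with (approxE _ st ts).
Qed.

End Stabilization.

(** The correction for s is read off after as many rounds as s has letters. *)
Lemma low_exists : exists low : Om -> seq Om -> V,
  [/\ forall i s, sorted ge s -> filt (size s) (low i s),
      forall i s, path ge i s -> low i s = 0
    & forall i j s, path ge j s -> ~~ le j i -> low i (j :: s) =
        malg_lift (act_with low j) (low i s)
        + malg_lift (act_with low ^~ s) (coord (lb (x i) (x j)))].
Proof.
have [L [L_path L_cons]] : exists L : nat -> Om -> seq Om -> V,
    (forall n i s, path ge i s -> L n i s = 0) /\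
    (forall n i j s, ~~ le j i -> L n.+1 i (j :: s) =
      malg_lift (act_with (L n) j) (L n i s)
      + malg_lift (act_with (L n) ^~ s) (coord (lb (x i) (x j)))).
  exists (fun n => iter n low_step (fun _ _ => 0)); split.
    by move=> [|n] i [|j s] //= /andP[ji _]; rewrite ifT.
  by move=> n i j s /negPf ij; rewrite iterS [LHS]/= ij.
exists (fun i s => L (size s) i s); split=> [i s ss|i s|i j s].
- by have [] := approx_stable L_path L_cons i ss (leqnn _).
- exact: L_path.
- exact: approx_diag_cons.
Qed.

Definition low : Om -> seq Om -> V := sval (cid low_exists).

Lemma filt_low i s : sorted ge s -> filt (size s) (low i s).
Proof. by have [+ _ _] := svalP (cid low_exists); apply. Qed.

Lemma low_path i s : path ge i s -> low i s = 0.
Proof. by have [_ + _] := svalP (cid low_exists); apply. Qed.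

Definition act i s := act_with low i s.

Lemma low_cons i j s : path ge j s -> ~~ le j i -> low i (j :: s) =
  malg_lift (act j) (low i s) + malg_lift (act ^~ s) (coord (lb (x i) (x j))).
Proof. by have [_ _ +] := svalP (cid low_exists); apply. Qed.

Definition rho y p : V := malg_lift (fun s => malg_lift (act ^~ s) (coord y)) p.

Lemma rho_linearr y : linear (rho y).
Proof. by move=> a p q; rewrite /rho linearP. Qed.

Lemma rho_linearl p : linear (rho^~ p).
Proof.
move=> a y z; rewrite /rho -malg_lift_fun_linear.
by apply: eq_malg_lift => s; rewrite !linearP.
Qed.
HB.instance Definition _ := bilinear_isBilinear.Build k g V V
  *:%R *:%R rho (rho_linearl, rho_linearr).

Lemma rho_basis j p : rho (x j) p = malg_lift (act j) p.
Proof. by apply: eq_malg_lift => s; rewrite basis_coord_basis malg_liftU. Qed.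

Lemma rho_act j s : rho (x j) << s >> = act j s.
Proof. by rewrite rho_basis malg_liftU. Qed.

Lemma rho_path i s : path ge i s -> rho (x i) << s >> = << i :: s >>.
Proof. by move=> si; rewrite rho_act /act /act_with insert_path // low_path // addr0. Qed.

Lemma rho_insert i s :
  sorted ge s -> filt (size s) (rho (x i) << s >> - << insert le i s >>).
Proof.
by move=> ss; rewrite rho_act /act /act_with [_ + low i s]addrC addrK; apply: filt_low.
Qed.

(** The definition of the correction, read backwards. *)
Lemma rho_cons i j s : path ge j s -> ~~ le j i ->
  rho (x i) << j :: s >>
  = rho (x j) (rho (x i) << s >>) + rho (lb (x i) (x j)) << s >>.
Proof.
move=> js ij; have jis : path ge j (insert le i s) by rewrite path_insert // lt_le.
have rhoD p q : rho (x j) (p + q) = rho (x j) p + rho (x j) q.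
  by have := rho_linearr (x j) 1 p q; rewrite !scale1r.
rewrite (rho_act i s) /act /act_with rhoD (rho_path jis) (rho_basis j).
rewrite [rho (lb _ _) _]malg_liftU rho_act /act /act_with.
by rewrite (low_cons js ij) [insert le i (j :: s)]/= (negPf ij) addrA.
Qed.

Lemma pbw_action_exists : exists r : {bilinear g -> V -> V},
  [/\ forall i s, path ge i s -> r (x i) << s >> = << i :: s >>,
      forall i s, sorted ge s ->
        filt (size s) (r (x i) << s >> - << insert le i s >>)
    & forall i j s, path ge j s -> ~~ le j i -> r (x i) << j :: s >> =
        r (x j) (r (x i) << s >>) + r (lb (x i) (x j)) << s >>].
Proof.
by exists rho; split; [exact: rho_path | exact: rho_insert | exact: rho_cons].
Qed.

End LieActionConstruction.

(** * The Poincare-Birkhoff-Witt theorem for Lie algebras *)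

Section LiePBW.
Variables (k : fieldType) (g : lmodType k) (lb : {bilinear g -> g -> g}).
Variables (Om : choiceType) (le : rel Om) (x : Om -> g).
Hypothesis le_total : total le.
Hypothesis x_basis : is_basis setT x setT.

Let ge : rel Om := fun i j => le j i.
Let pbw_sum : set (tens g) :=
  [set a + b | a in lie_ideal lb & b in lspan (pbw_words le x)].

Lemma pbw_sum_subspace : subspace pbw_sum.
Proof. by apply: subspace_plus; apply: lspan_subspace. Qed.

(* Words of length at most N are sorted modulo the relators; the error terms
   are shorter words, dealt with by an induction on N. *)
Section Rewriting.
Variable N : nat.
Hypothesis shorter : forall c, c != [::] -> (size c < N)%N -> pbw_sum (ptens c).

Lemma ptens_swap a b y w : (size (a ++ y :: w :: b) <= N)%N ->
  pbw_sum (ptens (a ++ y :: w :: b) - ptens (a ++ w :: y :: b)).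
Proof.
move=> sN; rewrite -[_ - _](subrK (ptens (a ++ lb y w :: b))).
apply: (subspaceD pbw_sum_subspace); last first.
  apply: shorter; first by case: a {sN}.
  by move: sN; rewrite !size_cat /= !addnS.
exists (lie_relator lb a b y w); first exact: mem_lie_ideal.
by exists 0; [have [] := lspan_subspace (pbw_words le x) | rewrite addr0].
Qed.

Lemma ptens_move_front a y t1 t2 : (size (a ++ y :: t1 ++ t2) <= N)%N ->
  pbw_sum (ptens (a ++ y :: t1 ++ t2) - ptens (a ++ t1 ++ y :: t2)).
Proof.
elim: t1 a => [|c t1 IH] a sN; first by rewrite subrr; have [] := pbw_sum_subspace.
rewrite -(subrKA (ptens (a ++ c :: y :: t1 ++ t2))).
apply: (subspaceD pbw_sum_subspace); first exact: ptens_swap.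
rewrite -cat_rcons -[a ++ (c :: t1) ++ _]cat_rcons; apply: IH.
by move: sN; rewrite !size_cat size_rcons /= !addnS.
Qed.

Lemma ptens_perm a s t : perm_eq s t -> (size (a ++ s) <= N)%N ->
  pbw_sum (ptens (a ++ s) - ptens (a ++ t)).
Proof.
elim: s a t => [|y s IH] a t st sN.
  move: st; rewrite perm_sym => /perm_nilP ->; rewrite subrr.
  by have [] := pbw_sum_subspace.
have yt : y \in t by rewrite -(perm_mem st) mem_head.
case/splitPr: yt st => t1 t2.
rewrite perm_sym -cat1s perm_catCA /= perm_cons perm_sym => st.
rewrite -(subrKA (ptens (a ++ y :: t1 ++ t2))).
apply: (subspaceD pbw_sum_subspace).
  rewrite -!cat_rcons; apply: IH => //.
  by move: sN; rewrite !size_cat size_rcons /= !addnS.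
apply: ptens_move_front.
by move: sN; rewrite !size_cat /= (perm_size st) size_cat.
Qed.

Lemma ptens_basis_word s : s != [::] -> (size s <= N)%N -> pbw_sum (ptens (map x s)).
Proof.
move=> s0 sN; pose t := sort ge s.
have st : perm_eq (map x s) (map x t) by rewrite perm_map // perm_sym perm_sort.
rewrite -[ptens _](subrK (ptens (map x t))); apply: (subspaceD pbw_sum_subspace).
  by apply: (@ptens_perm [::]); rewrite ?size_map.
exists 0; first by have [] := lie_ideal_subspace lb.
exists (ptens (map x t)); last by rewrite add0r.
apply: mem_lspan; exists t => //; split; last first.
  by apply: sort_sorted => i j; apply: le_total.
by rewrite -size_eq0 size_sort size_eq0.
Qed.

(** Multilinearity replaces the letters of a word over g by basis vectors, from
    right to left. *)
Lemma ptens_mixed_word a s :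
  a ++ map x s != [::] -> (size (a ++ map x s) <= N)%N -> pbw_sum (ptens (a ++ map x s)).
Proof.
elim/last_ind: a s => [|a y IH] s.
  by rewrite size_map -size_eq0 size_map size_eq0; apply: ptens_basis_word.
rewrite cat_rcons => nil sN.
elim/(basis_ind x_basis): y nil sN => [|i nil sN]; last first.
  by apply: (IH (i :: s)) => //; case: (a).
have E := @ptens_multilinear k g a (map x s).
have E0 : ptens (a ++ 0 :: map x s) = 0.
  by have := E (-1) 0 0; rewrite scaler0 addr0 scaleN1r addNr.
split=> [_ _|c u v Mu Mv _ sN]; first by rewrite E0; have [] := pbw_sum_subspace.
have sN' t : (size (a ++ t :: map x s) <= N)%N by move: sN; rewrite !size_cat.
by rewrite E; apply: pbw_sum_subspace.2; [apply: Mu | apply: Mv] => //; case: (a).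
Qed.

End Rewriting.

Lemma ptens_decomp c : c != [::] -> pbw_sum (ptens c).
Proof.
have [n] := ubnP (size c); elim: n c => // n IH c sc c0.
rewrite -[c]cats0; apply: (@ptens_mixed_word n _ c [::]); rewrite ?cats0 // => d d0 dn.
exact: IH.
Qed.

Lemma lie_ideal_sub_tplus : lie_ideal lb `<=` tplus g.
Proof.
have S : subspace (tplus g) := lspan_subspace _.
have T (s1 s2 : seq g) y : tplus g (ptens (s1 ++ y :: s2)).
  by apply: mem_lspan; exists (s1 ++ y :: s2) => //=; case: s1.
apply: (lspan_sub S) => _ [a [b [y [w ->]]]].
by do 2?[apply: (subspaceB S)]; apply: T.
Qed.

Lemma pbw_words_sub_tplus : lspan (pbw_words le x) `<=` tplus g.
Proof.
apply: lspan_le => _ [s [s0 _] <-]; exists (map x s) => //=.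
by rewrite -size_eq0 size_map size_eq0.
Qed.

Lemma tplus_decomp : tplus g = pbw_sum.
Proof.
apply/seteqP; split.
  by apply: (lspan_sub pbw_sum_subspace) => _ [c c0 <-]; apply: ptens_decomp.
have S : subspace (tplus g) := lspan_subspace _.
move=> _ [a Ia [b Wb <-]]; apply: (subspaceD S); first exact: lie_ideal_sub_tplus.
exact: pbw_words_sub_tplus.
Qed.

Hypothesis lbxx : forall y, lb y y = 0.
Hypothesis jacobi : forall y w t : g,
  lb y (lb w t) + lb w (lb t y) + lb t (lb y w) = 0.
Hypothesis le_anti : antisymmetric le.
Hypothesis le_trans : transitive le.

(** Such an N gives both the directness of the sum and the independence of the
    non-increasing words. *)
Lemma normal_form_exists : exists N : {linear tens g -> {malg k[seq Om]}},
  (forall t, lie_ideal lb t -> N t = 0) /\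
  (forall s, sorted ge s -> N (ptens (map x s)) = << s >>).
Proof.
have [r [r_path r_insert r_cons]] := pbw_action_exists lb le_total x_basis.
exists (normal_form r (fun s => << s >>)); split=> [t It|s ss].
  exact: (normal_form_lie_ideal le_anti le_trans le_total lbxx jacobi x_basis
    r_path r_insert r_cons).
rewrite /= normal_form_ptens; exact: (word_act_sorted r_path).
Qed.

Theorem lie_pbw :
  is_direct_sum (tplus g) (lie_ideal lb) (lspan (pbw_words le x))
  /\ free_set (pbw_words le x).
Proof.
have [N [N0 NW]] := normal_form_exists.
split; [split; first exact: tplus_decomp|].
  apply/seteqP; split=> [v [Iv Wv]|_ ->]; last first.
    split; first by have [] := lie_ideal_subspace lb.
    by have [] := lspan_subspace (pbw_words le x).
  (* N followed by the evaluation of words is the identity on the span of W. *)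
  have GN : lspan (pbw_words le x) `<=`
      [set v | malg_lift (fun s => ptens (map x s)) (N v) - v = 0].
    apply: lspan_sub; last by move=> _ [s [_ ss] <-] /=; rewrite NW // malg_liftU subrr.
    pose f v := malg_lift (fun s => ptens (map x s)) (N v).
    have Lf : linear f := linear_comp (linearP N) (malg_lift_linear _).
    exact: subspace_linear_eq0 (linear_sub (h := id) Lf _).
  by have /eqP := GN v Wv; rewrite N0 // linear0 sub0r oppr_eq0 => /eqP.
move=> ws c uws wsW sum0 w0 w0s; have [s0 [_ ss0] Ew0] := wsW w0 w0s.
have : (N (\sum_(w <- ws) c w *: w))@_s0 = 0 by rewrite sum0 linear0 mcoeff0.
(* The coefficient of << s0 >> in the image of the dependency is c w0. *)
rewrite linear_sum raddf_sum /= (bigD1_seq w0) //= big1_seq ?addr0; last first.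
  move=> w /andP[ww0 /wsW[s [_ ss] Ew]].
  rewrite linearZ mcoeffZ -Ew NW // mcoeffU; case: eqP => [ss0E|]; last by rewrite mulr0.
  by move: ww0; rewrite -Ew -Ew0 ss0E eqxx.
by rewrite linearZ mcoeffZ -Ew0 NW // mcoeffUU mulr1.
Qed.

End LiePBW.

(** * Untwisting the Hom-structure *)

Section LinearEq.
Variables (k : fieldType) (V W : lmodType k).

Lemma lspan_eq_linear (f h : V -> W) (A : set V) :
  linear f -> linear h -> (forall a, A a -> f a = h a) ->
  forall v, lspan A v -> f v = h v.
Proof.
move=> Lf Lh fh v /(@lspan_sub _ _ _ [set v | f v - h v = 0]) Av.
apply/eqP; rewrite -subr_eq0; apply/eqP/Av => [|a /fh /= ->]; last exact: subrr.
exact: subspace_linear_eq0 (linear_sub Lf Lh).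
Qed.

End LinearEq.

Section Tensors.
Variables (k : fieldType) (g : lmodType k).
Implicit Types (s t : seq g) (u v : tens g).

Lemma tplus_subspace : subspace (tplus g).
Proof. exact: lspan_subspace. Qed.

Lemma ptens_tplus s : s != [::] -> tplus g (ptens s).
Proof. by move=> s0; apply: mem_lspan; exists s. Qed.

Lemma tens_eq_linear (W : lmodType k) (f h : tens g -> W) :
  linear f -> linear h -> (forall s, f (ptens s) = h (ptens s)) -> f =1 h.
Proof.
move=> Lf Lh fh; apply: tens_ind => //.
have [S0 SP] := subspace_linear_eq0 (linear_sub Lf Lh).
have E v : f v = h v <-> f v - h v = 0.
  by split=> [->|/eqP]; rewrite ?subrr // subr_eq0 => /eqP.
by split=> [|a u v /E u0 /E v0]; apply/E; [exact: S0 | apply: SP].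
Qed.

Lemma tmul_nil_l u : tmul (ptens [::]) u = u.
Proof.
move: u; apply: (tens_eq_linear (h := id) (tmul_linearr _)) => // s.
by rewrite tmul_ptens.
Qed.

Lemma tmul_nil_r u : tmul u (ptens [::]) = u.
Proof.
move: u; apply: (tens_eq_linear (h := id) (tmul_linearl _)) => // s.
by rewrite tmul_ptens cats0.
Qed.

Lemma tmul_tplus u v : tplus g u -> tplus g v -> tplus g (tmul u v).
Proof.
move=> Tu Tv; move: v Tv.
apply: (lspan_linear (tmul_linearr u) tplus_subspace) => _ [t t0 <-].
move: u Tu; apply: (lspan_linear (tmul_linearl (ptens t)) tplus_subspace).
by move=> _ [s s0 <-] /=; rewrite tmul_ptens; apply: ptens_tplus; case: s s0.
Qed.

End Tensors.

Section Untwisting.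
Variables (k : fieldType) (g : lmodType k).
Variables (br : {bilinear g -> g -> g}) (beta : {linear g -> g}).
Hypothesis hom_lie_g : is_hom_lie br beta.
Hypothesis betaK : involutive beta.
Implicit Types (s t : seq g) (u v : tens g) (y w : g) (b c : bool).

Definition untwisted_bracket y w : g := beta (br y w).

Lemma untwisted_bracket_linearl w : linear (untwisted_bracket^~ w).
Proof. by move=> a y y'; rewrite /untwisted_bracket linearPl linearP. Qed.

Lemma untwisted_bracket_linearr y : linear (untwisted_bracket y).
Proof. by move=> a w w'; rewrite /untwisted_bracket linearPr linearP. Qed.
HB.instance Definition _ := bilinear_isBilinear.Build k g g g
  *:%R *:%R untwisted_bracket (untwisted_bracket_linearl, untwisted_bracket_linearr).

Local Notation lb := (untwisted_bracket : {bilinear g -> g -> g}).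

Lemma untwisted_bracketE y w : lb y w = br (beta y) (beta w).
Proof. exact: hom_lie_mult. Qed.

Lemma untwisted_bracket_alternating :
  2%N \notin [pchar k] -> forall y, lb y y = 0.
Proof.
move=> char2 y; have two : 2%:R != 0 :> k by move: char2; rewrite !inE.
have: 2%:R *: br y y = 0.
  by rewrite scaler_nat mulr2n {1}(hom_lie_skew hom_lie_g) addNr.
move/eqP; rewrite scaler_eq0 (negPf two) /= => /eqP E.
by rewrite /= /untwisted_bracket E linear0.
Qed.

(** As beta is an involution, {y, {w, t}} = [beta y, [w, t]]: the sum is the
    Hom-Jacobi sum. *)
Lemma untwisted_bracket_jacobi y w (t : g) :
  lb y (lb w t) + lb w (lb t y) + lb t (lb y w) = 0.
Proof.
have E (y1 y2 y3 : g) : lb y1 (lb y2 y3) = br (beta y1) (br y2 y3).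
  by rewrite untwisted_bracketE /= /untwisted_bracket betaK.
by rewrite !E hom_lie_jacobi.
Qed.

(** Powers of beta depend on the parity of the exponent only; they are kept as
    booleans, and compose by exclusive or. *)
Definition beta_if b y : g := if b then beta y else y.

Lemma beta_ifP b a y w : beta_if b (a *: y + w) = a *: beta_if b y + beta_if b w.
Proof. by case: b => //=; rewrite linearP. Qed.

Lemma map_beta_if b c s : map (beta_if b) (map (beta_if c) s) = map (beta_if (b (+) c)) s.
Proof.
by rewrite -map_comp; apply: eq_map => y; case: b; case: c => /=; rewrite ?betaK.
Qed.

Lemma beta_if_if b c y : beta_if b (beta_if c y) = beta_if (b (+) c) y.
Proof. by case: b; case: c => /=; rewrite ?betaK. Qed.

Lemma map_beta_false s : map (beta_if false) s = s.
Proof. exact: map_id. Qed.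

Lemma map_betaE s : map beta s = map (beta_if true) s.
Proof. by []. Qed.

Lemma beta_if_lb b y w : beta_if b (lb y w) = lb (beta_if b y) (beta_if b w).
Proof.
case: b => //=.
by rewrite /untwisted_bracket (hom_lie_mult hom_lie_g).
Qed.

(** The twist operator fixes the first letter although its position is odd, so
    it alternates from the second letter on only (twist_word_cons). *)
Fixpoint alternate b s : seq g :=
  if s is y :: s' then beta_if b y :: alternate (~~ b) s' else [::].

Lemma alternate_map b c s :
  alternate b (map (beta_if c) s) = map (beta_if c) (alternate b s).
Proof. by elim: s b => //= y s IH b; rewrite IH !beta_if_if addbC. Qed.

Lemma alternate_addb b c s : alternate (b (+) c) s = map (beta_if b) (alternate c s).
Proof. by elim: s c => //= y s IH c; rewrite beta_if_if -addbN IH. Qed.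

Lemma alternate_cat b s t :
  alternate b (s ++ t) = alternate b s ++ alternate (b (+) odd (size s)) t.
Proof.
elim: s b => [|y s IH] b /=; first by rewrite addbF.
by rewrite IH addNb addbN.
Qed.

Lemma size_alternate b s : size (alternate b s) = size s.
Proof. by elim: s b => //= y s IH b; rewrite IH. Qed.

Lemma alternateK b s : alternate b (alternate b s) = s.
Proof. by elim: s b => //= y s IH b; rewrite IH beta_if_if addbb. Qed.

Lemma twist_letters n s : (2 <= n)%N ->
  [seq twist_letter beta p.1 p.2 | p <- zip (iota n (size s)) s]
  = alternate (odd n) s.
Proof.
elim: s n => //= y s IH n n2; rewrite IH ?leqW //; congr (_ :: _).
have odd3 : odd n && (3 <= n)%N = odd n.
  by case: n n2 => [|[|[|n]]] // _; rewrite andbT.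
by rewrite /twist_letter /beta_if odd3.
Qed.

Lemma twist_word_cons y s : twist_word beta (y :: s) = y :: alternate false s.
Proof. by rewrite /twist_word /= twist_letters. Qed.

(** The map psi: beta^(n-1) on each letter of a word of length n. *)
Definition deg_twist_word s := map (beta_if (~~ odd (size s))) s.

Definition deg_twist : tens g -> tens g := tens_lift (fun s => ptens (deg_twist_word s)).

Lemma deg_twist_word_multilinear : word_multilinear (fun s => ptens (deg_twist_word s)).
Proof.
move=> s1 s2 a y w; rewrite /deg_twist_word !size_cat /= !map_cat /=.
by rewrite beta_ifP ptens_multilinear.
Qed.

Lemma deg_twist_ptens s : deg_twist (ptens s) = ptens (deg_twist_word s).
Proof. exact: (tens_lift_ptens deg_twist_word_multilinear). Qed.

Lemma deg_twist_linear : linear deg_twist.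
Proof. exact: (tens_lift_linear deg_twist_word_multilinear). Qed.
HB.instance Definition _ :=
  GRing.isLinear.Build k (tens g) (tens g) *:%R deg_twist deg_twist_linear.

Lemma deg_twistK : involutive deg_twist.
Proof.
have L := deg_twist_linear.
apply: (tens_eq_linear (h := id) (linear_comp L L)) => // s.
by rewrite !deg_twist_ptens /deg_twist_word size_map map_beta_if addbb map_beta_false.
Qed.

Lemma twistK : involutive (twist beta).
Proof.
have L := twist_linear beta.
apply: (tens_eq_linear (h := id) (linear_comp L L)) => // -[|y s].
  by rewrite !twist_ptens.
by rewrite !twist_ptens !twist_word_cons alternateK.
Qed.

Lemma alphaTK : involutive (alphaT beta).
Proof.
have L := alphaT_linear beta.
apply: (tens_eq_linear (h := id) (linear_comp L L)) => // s.
by rewrite !alphaT_ptens !map_betaE map_beta_if map_beta_false.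
Qed.

Lemma size_twist_word s : size (twist_word beta s) = size s.
Proof. by case: s => // y s; rewrite twist_word_cons /= size_alternate. Qed.

Lemma twist_word_map b s :
  twist_word beta (map (beta_if b) s) = map (beta_if b) (twist_word beta s).
Proof.
case: s => [//|y s]; rewrite [map _ (_ :: _)]/= !twist_word_cons alternate_map.
by [].
Qed.

Lemma deg_twist_twist u : deg_twist (twist beta u) = twist beta (deg_twist u).
Proof.
have [LD LT] := (deg_twist_linear, twist_linear beta).
move: u; apply: (tens_eq_linear (linear_comp LT LD) (linear_comp LD LT)) => s.
rewrite twist_ptens !deg_twist_ptens twist_ptens /deg_twist_word.
by rewrite twist_word_map size_twist_word.
Qed.

Lemma alphaT_tmul u v : alphaT beta (tmul u v) = tmul (alphaT beta u) (alphaT beta v).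
Proof.
have LA := alphaT_linear beta.
move: u; apply: (tens_eq_linear (linear_comp (tmul_linearl v) LA)
                   (linear_comp LA (tmul_linearl _))) => s.
move: v; apply: (tens_eq_linear (linear_comp (tmul_linearr _) LA)
                   (linear_comp LA (tmul_linearr _))) => t.
by rewrite tmul_ptens !alphaT_ptens tmul_ptens map_cat.
Qed.

(** The map Phi, which turns the Hom-product into the tensor product followed by
    alpha_T. *)
Definition untwist u := deg_twist (twist beta u).

Lemma untwist_linear : linear untwist.
Proof. exact: linear_comp (twist_linear beta) deg_twist_linear. Qed.
HB.instance Definition _ :=
  GRing.isLinear.Build k (tens g) (tens g) *:%R untwist untwist_linear.

Lemma untwistK : involutive untwist.
Proof. by move=> u; rewrite /untwist deg_twist_twist deg_twistK twistK. Qed.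

Lemma untwist_word y s : untwist (ptens (y :: s))
  = ptens (map (beta_if (odd (size s))) (y :: alternate false s)).
Proof.
rewrite /untwist twist_ptens twist_word_cons deg_twist_ptens /deg_twist_word.
by rewrite /= size_alternate negbK.
Qed.

(** Each letter of the right factor but the first applies alpha_T once to
    the left factor, and is itself twisted once. *)
Lemma hodot_ptens_cons s y t : hodot beta (ptens s) (ptens (y :: t))
  = ptens (map (beta_if (odd (size t))) s ++ y :: map beta t).
Proof.
elim/last_ind: t s => [|t w IH] s.
  by rewrite hodot_ptens1 tmul_ptens map_beta_false.
rewrite -rcons_cons hodot_ptens_rcons // !alphaT_ptens IH tmul_ptens.
rewrite -catA /= cats1 map_rcons size_rcons map_betaE map_beta_if.
by rewrite addbT.
Qed.

(** A count of the parity of the power of beta on each letter. *)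
Lemma untwist_hodot_word s t : s != [::] -> t != [::] ->
  untwist (hodot beta (ptens s) (ptens t))
  = alphaT beta (tmul (untwist (ptens s)) (untwist (ptens t))).
Proof.
case: s => // y s _; case: t => // w t _.
rewrite hodot_ptens_cons /= !untwist_word tmul_ptens alphaT_ptens; congr ptens.
rewrite [RHS]map_betaE alternate_cat size_map alternate_map /= map_betaE alternate_map.
rewrite -[~~ _](addbF) alternate_addb.
rewrite !map_cat /= !map_beta_if !beta_if_if size_cat /= !size_map addnS /= oddD.
by case: (odd (size s)); case: (odd (size t)); rewrite /= ?betaK.
Qed.

End Untwisting.

(** * Comparing the ideals *)

Section Ideals.
Variables (k : fieldType) (g : lmodType k).
Variables (br : {bilinear g -> g -> g}) (beta : {linear g -> g}).
Hypothesis hom_lie_g : is_hom_lie br beta.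
Hypothesis betaK : involutive beta.
Implicit Types (s t a b : seq g) (u v r : tens g) (y w : g).

Local Notation lb := (untwisted_bracket br beta : {bilinear g -> g -> g}).
Local Notation alphaT := (alphaT beta).
Local Notation untwist := (untwist beta).
Local Notation deg_twist := (deg_twist beta).

Lemma deg_twist_tplus u : tplus g u -> tplus g (deg_twist u).
Proof.
move: u; apply: (lspan_linear (deg_twist_linear beta) (tplus_subspace g)).
move=> _ [s s0 <-]; rewrite deg_twist_ptens; apply: ptens_tplus.
by case: s s0.
Qed.

Lemma twist_tplus u : tplus g u -> tplus g (twist beta u).
Proof.
move: u; apply: (lspan_linear (twist_linear beta) (tplus_subspace g)).
move=> _ [s s0 <-]; rewrite twist_ptens; apply: ptens_tplus.
by case: s s0.
Qed.

Lemma untwist_tplus u : tplus g u -> tplus g (untwist u).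
Proof. by move=> Tu; apply: deg_twist_tplus; apply: twist_tplus. Qed.

Lemma alphaT_tplus u : tplus g u -> tplus g (alphaT u).
Proof.
move: u; apply: (lspan_linear (alphaT_linear beta) (tplus_subspace g)).
move=> _ [s s0 <-]; rewrite alphaT_ptens; apply: ptens_tplus.
by case: s s0.
Qed.

Lemma untwist_alphaT u : untwist (alphaT u) = alphaT (untwist u).
Proof.
have [LA LU] := (alphaT_linear beta, @untwist_linear k g beta).
move: u; apply: (tens_eq_linear (linear_comp LA LU) (linear_comp LU LA)) => s.
rewrite alphaT_ptens /untwist !twist_ptens !deg_twist_ptens alphaT_ptens.
rewrite /deg_twist_word !map_betaE (twist_word_map betaK) size_map !map_beta_if //.
by rewrite addbC.
Qed.

Lemma untwist_hodot u v : tplus g u -> tplus g v ->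
  untwist (hodot beta u v) = alphaT (tmul (untwist u) (untwist v)).
Proof.
have [LA LU] := (alphaT_linear beta, @untwist_linear k g beta).
move=> Tu Tv; move: v Tv.
apply: (lspan_eq_linear (linear_comp (hodot_linearr beta u) LU)
  (linear_comp (linear_comp LU (tmul_linearr _)) LA)) => _ [t t0 <-].
move: u Tu.
apply: (lspan_eq_linear (linear_comp (hodot_linearl beta _) LU)
  (linear_comp (linear_comp LU (tmul_linearl _)) LA)) => _ [s s0 <-].
exact: untwist_hodot_word.
Qed.

Lemma hodot_tplus u v : tplus g u -> tplus g v -> tplus g (hodot beta u v).
Proof.
move=> Tu Tv; rewrite -[hodot _ _ _](untwistK betaK) untwist_hodot //.
by apply: untwist_tplus; apply: alphaT_tplus; apply: tmul_tplus; apply: untwist_tplus.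
Qed.

Lemma lie_ideal_tmull u r : lie_ideal lb r -> lie_ideal lb (tmul u r).
Proof.
have S := lie_ideal_subspace lb; move=> Ir; elim/tens_ind: u => [|s].
  exact: (subspace_preim (tmul_linearl r) S).
move: r Ir; apply: (lspan_linear (tmul_linearr _) S) => _ [a [b [y [w ->]]]].
rewrite /lie_relator !linearBr /= !tmul_ptens !catA; exact: mem_lie_ideal.
Qed.

Lemma lie_ideal_tmulr u r : lie_ideal lb r -> lie_ideal lb (tmul r u).
Proof.
have S := lie_ideal_subspace lb; move=> Ir; elim/tens_ind: u => [|s].
  exact: (subspace_preim (tmul_linearr r) S).
move: r Ir; apply: (lspan_linear (tmul_linearl _) S) => _ [a [b [y [w ->]]]].
rewrite /lie_relator !linearBl /= !tmul_ptens -!catA; exact: mem_lie_ideal.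
Qed.

Lemma map_beta_lie_relator c a b y w :
  ptens (map (beta_if beta c) (a ++ y :: w :: b))
  - ptens (map (beta_if beta c) (a ++ w :: y :: b))
  - ptens (map (beta_if beta c) (a ++ lb y w :: b))
  = lie_relator lb (map (beta_if beta c) a) (map (beta_if beta c) b)
      (beta_if beta c y) (beta_if beta c w).
Proof. by rewrite !map_cat /= (beta_if_lb hom_lie_g). Qed.

Lemma lie_ideal_alphaT r : lie_ideal lb r -> lie_ideal lb (alphaT r).
Proof.
have S := lie_ideal_subspace lb.
move: r; apply: (lspan_linear (alphaT_linear _) S) => _ [a [b [y [w ->]]]].
rewrite {1}/lie_relator !linearB /= !alphaT_ptens !map_betaE map_beta_lie_relator.
exact: mem_lie_ideal.
Qed.

(** In degree 2, untwist applies beta to both letters; in degree 1 it is the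
    identity, and [y, w] = {beta y, beta w}. *)
Lemma env_generator y w :
  untwist (tmul (ptens [:: y]) (ptens [:: w]) - tmul (ptens [:: w]) (ptens [:: y])
           - ptens [:: br y w])
  = lie_relator lb [::] [::] (beta y) (beta w).
Proof.
rewrite !tmul_ptens !linearB /= !untwist_word //.
by rewrite /lie_relator /= (untwisted_bracketE hom_lie_g) !betaK.
Qed.

(** The preimage of the Lie ideal under untwist is a Hom-ideal containing the
    generators. *)
Lemma untwist_env_ideal u : env_ideal br beta u -> lie_ideal lb (untwist u).
Proof.
have S := lie_ideal_subspace lb; have T := tplus_subspace g.
have LU := @untwist_linear k g beta.
move=> Iu; suff [] : tplus g u /\ lie_ideal lb (untwist u) by [].
move: u Iu; apply: (@smallest_sub _ _ _ [set u | tplus g u /\ lie_ideal lb (untwist u)]).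
  split.
  - split; first by split; [have [] := T | have [] := subspace_preim LU S].
    move=> c u v [Tu Iu] [Tv Iv]; split; first exact: T.2.
    exact: (subspace_preim LU S).2.
  - by move=> u [].
  - move=> u v [Tu Iu] Tv; split; split; try exact: hodot_tplus.
      by rewrite untwist_hodot //; apply: lie_ideal_alphaT; apply: lie_ideal_tmulr.
    by rewrite untwist_hodot //; apply: lie_ideal_alphaT; apply: lie_ideal_tmull.
  move=> u [Tu Iu]; split; first exact: alphaT_tplus.
  by rewrite untwist_alphaT; apply: lie_ideal_alphaT.
move=> _ [y [w ->]]; split.
  by rewrite !tmul_ptens; do 2?[apply: (subspaceB T)]; apply: ptens_tplus.
rewrite env_generator; exact: mem_lie_ideal.
Qed.

Lemma env_ideal_hom_ideal : is_hom_ideal beta (env_ideal br beta).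
Proof.
have S := @env_ideal_subspace k g br beta.
have E u : env_ideal br beta u -> forall I, is_hom_ideal beta I ->
    [set r | exists y w : g,
      r = tmul (ptens [:: y]) (ptens [:: w]) - tmul (ptens [:: w]) (ptens [:: y])
          - ptens [:: br y w]] `<=` I -> I u.
  by move=> Iu I HI GI; apply: Iu.
split=> //.
- move=> u Iu; apply: (E u Iu) => [|_ [y [w ->]]].
    split; first exact: tplus_subspace.
    + by [].
    + by move=> u' v Tu Tv; split; apply: hodot_tplus.
    + exact: alphaT_tplus.
  have T := tplus_subspace g.
  by rewrite !tmul_ptens; do 2?[apply: (subspaceB T)]; apply: ptens_tplus.
- move=> u v Iu Tv; split=> I [HI GI]; have [_ _ mul _] := HI.
    by have [] := mul u v (E u Iu I HI GI) Tv.
  by have [] := mul u v (E u Iu I HI GI) Tv.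
- by move=> u Iu I [HI GI]; have [_ _ _] := HI; apply; apply: (E u Iu I HI GI).
Qed.

(** The preimage of the Hom-ideal is a two-sided ideal because
    untwist (u v) = untwist (alpha_T u) (.) untwist (alpha_T v); so only the
    relators with empty a and b are left to check. *)
Lemma untwist_lie_ideal r : lie_ideal lb r -> env_ideal br beta (untwist r).
Proof.
have [S sub mul al] := env_ideal_hom_ideal.
have LU := @untwist_linear k g beta.
have mulE u v : tplus g u -> tplus g v ->
    untwist (tmul u v) = hodot beta (untwist (alphaT u)) (untwist (alphaT v)).
  move=> Tu Tv; rewrite -[RHS](untwistK betaK) untwist_hodot ?(untwistK betaK).
  - by rewrite (alphaT_tmul beta) !(alphaTK betaK).
  - by apply: untwist_tplus; apply: alphaT_tplus.
  - by apply: untwist_tplus; apply: alphaT_tplus.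
have mull u v : tplus g u -> env_ideal br beta (untwist u) -> tplus g v ->
    env_ideal br beta (untwist (tmul u v)) /\ env_ideal br beta (untwist (tmul v u)).
  move=> Tu Iu Tv; rewrite !mulE // !untwist_alphaT; apply: mul; first exact: al.
  by rewrite -untwist_alphaT; apply: untwist_tplus; apply: alphaT_tplus.
move: r; apply: (lspan_linear LU S) => _ [a [b [y [w ->]]]].
have T0 : tplus g (lie_relator lb [::] [::] y w).
  by apply: lie_ideal_sub_tplus; apply: mem_lie_ideal.
have I0 : env_ideal br beta (untwist (lie_relator lb [::] [::] y w)).
  rewrite -[y]betaK -[w]betaK -env_generator (untwistK betaK).
  by apply: sub_gen_smallest; exists (beta y), (beta w).
have -> : lie_relator lb a b y w
    = tmul (ptens a) (tmul (lie_relator lb [::] [::] y w) (ptens b)).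
  by rewrite /lie_relator !linearBl /= !linearBr /= !tmul_ptens.
have [Tb Ib] : tplus g (tmul (lie_relator lb [::] [::] y w) (ptens b)) /\
    env_ideal br beta (untwist (tmul (lie_relator lb [::] [::] y w) (ptens b))).
  case: b => [|c b]; first by rewrite tmul_nil_r.
  by split; [apply: tmul_tplus => //; apply: ptens_tplus
            | apply: (mull _ _ T0 I0 _).1; apply: ptens_tplus].
case: a => [|c a]; first by rewrite tmul_nil_l.
by apply: (mull _ _ Tb Ib _).2; apply: ptens_tplus.
Qed.

(** The generators of J with pure tensors a and b; they span J as well
    (deg_twist_pbw_space). *)
Definition hom_relator a b y w : tens g :=
  ptens (a ++ y :: w :: b) - ptens (a ++ w :: y :: b)
  - ptens (map beta a ++ br y w :: map beta b).

(** The leading terms have one letter more than the correction term, so beta is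
    applied once less to the letters of the latter; this makes up for the beta on
    its letters from a and b, and turns br into the untwisted bracket. *)
Lemma deg_twist_hom_relator a b y w :
  let bt := beta_if beta (~~ odd (size a + size b)) in
  deg_twist (hom_relator a b y w) = lie_relator lb (map bt a) (map bt b) (bt y) (bt w).
Proof.
rewrite /= -map_beta_lie_relator /hom_relator !linearB /= !deg_twist_ptens.
rewrite /deg_twist_word !size_cat /= !size_map !addnS /= negbK.
congr (_ - ptens _).
rewrite !map_cat /= !map_betaE !map_beta_if // /untwisted_bracket.
by case: odd => /=; rewrite ?betaK.
Qed.

Lemma tpow_ptens s : tpow g (size s) (ptens s).
Proof. by apply: mem_lspan; exists s. Qed.

Lemma pbw_space_hom_relator a b y w : pbw_space br beta (hom_relator a b y w).
Proof.
apply: mem_lspan; exists (size a), (size b), (ptens a), (ptens b), y, w.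
split; [exact: tpow_ptens | exact: tpow_ptens|].
by rewrite !linearBr /= !linearBl /= !alphaT_ptens !tmul_ptens -!catA.
Qed.

Lemma deg_twist_lie_ideal u : lie_ideal lb u -> pbw_space br beta (deg_twist u).
Proof.
have S : subspace (pbw_space br beta) := lspan_subspace _.
move: u; apply: (lspan_linear (deg_twist_linear beta) S) => _ [a [b [y [w ->]]]].
pose bt := beta_if beta (~~ odd (size a + size b)).
have -> : lie_relator lb a b y w
    = deg_twist (hom_relator (map bt a) (map bt b) (bt y) (bt w)).
  rewrite deg_twist_hom_relator !size_map !map_beta_if // !beta_if_if //.
  by rewrite !addbb !map_beta_false.
by rewrite (deg_twistK betaK); apply: pbw_space_hom_relator.
Qed.

Lemma deg_twist_pbw_space u : pbw_space br beta u -> lie_ideal lb (deg_twist u).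
Proof.
have S := lie_ideal_subspace lb; have LD := deg_twist_linear beta.
move: u; apply: (lspan_linear LD S) => _ [i [j [a [b [y [w [Ta Tb ->]]]]]]].
(* Bilinearity in a and b reduces the claim to pure tensors. *)
pose h (a b : tens g) := tmul (tmul a (tmul (ptens [:: y]) (ptens [:: w])
      - tmul (ptens [:: w]) (ptens [:: y]))) b
    - tmul (tmul (alphaT a) (ptens [:: br y w])) (alphaT b).
have LA := alphaT_linear beta.
have hl (b' : tens g) : linear (h^~ b').
  apply: linear_sub.
    exact: linear_comp (tmul_linearl _) (tmul_linearl b').
  exact: (linear_comp (linear_comp LA (tmul_linearl _)) (tmul_linearl (alphaT b'))).
have hr (a' : tens g) : linear (h a').
  apply: linear_sub; first exact: tmul_linearr.
  exact: linear_comp LA (tmul_linearr _).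
rewrite -/(h a b).
have LDl (b' : tens g) := linear_comp (hl b') LD.
have LDr (a' : tens g) := linear_comp (hr a') LD.
move: a Ta; apply: (lspan_linear (LDl b) S) => _ [s _ <-].
move: b Tb; apply: (lspan_linear (LDr _) S) => _ [t _ <-].
have -> : h (ptens s) (ptens t) = hom_relator s t y w.
  by rewrite /h !linearBr /= !linearBl /= !alphaT_ptens !tmul_ptens -!catA.
rewrite deg_twist_hom_relator; exact: mem_lie_ideal.
Qed.

End Ideals.

(** * The theorem for Hom-Lie algebras *)

Lemma well_order_total_order (T : eqType) (R : rel T) :
  well_order R -> [/\ antisymmetric R, transitive R & total R].
Proof.
move=> wo; have chain := withinW (A := predT) wo.
have anti : antisymmetric R by move=> x y; apply: (wo_chain_antisymmetric chain).
split=> // [y x z xy yz|x y]; last exact: (wo_chainW chain).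
have [m [[]]] := wo [pred t in [:: x; y; z]] (ex_intro _ x (mem_head _ _)).
rewrite !inE => mxyz mle _.
have [mx my mz] : [/\ R m x, R m y & R m z].
  by split; apply: mle; rewrite !inE eqxx ?orbT.
case/or3P: mxyz => /eqP mE; rewrite mE in mx my mz; first exact: mz.
  by rewrite (anti x y) ?yz // xy.
by rewrite -(anti y z) ?xy // yz.
Qed.

Section EigenWords.
Variables (k : fieldType) (g : lmodType k) (beta : {linear g -> g}).
Variables (Om : choiceType) (le : rel Om) (x : Om -> g).
Hypothesis x_eigen : forall i, beta (x i) = x i \/ beta (x i) = - x i.

Lemma ptens_map_eigen s :
  exists c : k, ptens (map beta (map x s)) = c *: ptens (map x s).
Proof.
have scale (c : k) (y : g) (t : seq g) : ptens (c *: y :: t) = c *: ptens (y :: t).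
  have E := @ptens_multilinear k g [::] t.
  have E0 : ptens (0 :: t) = 0.
    by have := E (-1) 0 0; rewrite scaler0 addr0 scaleN1r addNr.
  by have := E c y 0; rewrite addr0 [[::] ++ 0 :: t]/= E0 addr0.
elim: s => [|i s [c IH]] /=; first by exists 1; rewrite scale1r.
have [d ->] : exists d : k, beta (x i) = d *: x i.
  have [->|->] := x_eigen i; first by exists 1; rewrite scale1r.
  by exists (-1); rewrite scaleN1r.
have consE (t : seq g) : ptens (x i :: t) = tmul (ptens [:: x i]) (ptens t).
  by rewrite tmul_ptens.
exists (d * c); rewrite scale (consE (map beta _)) IH (consE (map x s)).
by rewrite linearZr_LR /= scalerA.
Qed.

(** On words in eigenvectors the map psi is multiplication by a scalar. *)
Lemma deg_twist_pbw_words u :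
  lspan (pbw_words le x) u -> lspan (pbw_words le x) (deg_twist beta u).
Proof.
have S := lspan_subspace (pbw_words le x).
move: u; apply: (lspan_linear (deg_twist_linear beta) S) => u Wu.
have [s _ Eu] := Wu; have [c Ec] := ptens_map_eigen s.
rewrite -Eu deg_twist_ptens /deg_twist_word; case: (~~ _); last first.
  by rewrite map_beta_false Eu; apply: mem_lspan.
by rewrite -map_betaE Ec; apply: (subspaceZ _ S); rewrite Eu; apply: mem_lspan.
Qed.

End EigenWords.

Theorem theorem4p3 (k : fieldType) (char_k : 2%N \notin [pchar k])
    (g : lmodType k) (br : {bilinear g -> g -> g}) (beta : {linear g -> g})
    (hom_lie_g : is_hom_lie br beta) (invol_g : involutive beta) :
  exists (Om : choiceType) (le : rel Om) (x : Om -> g),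
    [/\ well_order le,
        is_basis setT x setT,
        is_direct_sum (tplus g) (pbw_space br beta) (lspan (pbw_words le x))
      & is_basis (pbw_words le x)
          (fun w => coset (env_ideal br beta) (twist beta w))
          (env_alg br beta)].
Proof.
have [Om [le [x [le_wo x_basis x_eigen]]]] := involution_eigenbasis char_k invol_g.
have [le_anti le_trans le_total] := well_order_total_order le_wo.
pose lb : {bilinear g -> g -> g} := untwisted_bracket br beta.
pose J := pbw_space br beta; pose W := lspan (pbw_words le x).
have [[TE I0] W_free] := lie_pbw le_total x_basis
  (untwisted_bracket_alternating hom_lie_g char_k)
  (untwisted_bracket_jacobi hom_lie_g invol_g) le_anti le_trans.
have dK := deg_twistK invol_g.
have WT : W `<=` tplus g by exact: pbw_words_sub_tplus.
have SJ : subspace J := lspan_subspace _.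
have SW : subspace W := lspan_subspace _.
have SI := @env_ideal_subspace k g br beta.
have dW u : W u -> W (deg_twist beta u) by apply: deg_twist_pbw_words.
have dJ u : J u -> lie_ideal lb (deg_twist beta u) by apply: deg_twist_pbw_space.
have dL u : lie_ideal lb u -> J (deg_twist beta u) by apply: deg_twist_lie_ideal.
(* The decomposition for the Lie algebra is carried over by deg_twist. *)
have TJW : tplus g = [set a + b | a in J & b in W].
  apply/seteqP; split=> [v Tv|_ [a Ja [b Wb <-]]].
    have : tplus g (deg_twist beta v) by apply: deg_twist_tplus.
    rewrite TE => -[a Ia [b Wb ab]].
    exists (deg_twist beta a); first exact: dL.
    exists (deg_twist beta b); first exact: dW.
    by rewrite -(linear_add (deg_twist_linear beta)) ab dK.
  apply: (subspaceD (tplus_subspace g)); last exact: WT.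
  rewrite -[a]dK; apply: deg_twist_tplus.
  exact: lie_ideal_sub_tplus (dJ _ Ja).
have JW0 u : J u -> W u -> u = 0.
  move=> Ju Wu; have : (lie_ideal lb `&` W) (deg_twist beta u).
    by split; [exact: dJ | exact: dW].
  by rewrite I0 /= => du0; rewrite -[u]dK du0 (linear_zero (deg_twist_linear beta)).
exists Om, le, x; split=> //.
  split=> //; apply/seteqP; split=> [u [Ju Wu]|_ ->]; first exact: JW0.
  by split; [have [] := SJ | have [] := SW].
have LT := twist_linear beta.
have LC := coset_is_linear (env_ideal br beta).
have LCT := linear_comp LT LC.
split=> [ws c uws wsW sum0|].
  pose S := \sum_(w <- ws) c w *: w.
  have WS : W S.
    apply: (subspace_sum SW) => w /wsW Ww; apply: (subspaceZ _ SW).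
    exact: mem_lspan.
  have : env_ideal br beta (twist beta S).
    rewrite -(lspan_id SI) -[twist beta S]subr0; apply/cosetP.
    by rewrite (linear_zero LC) (linear_combination LCT).
  move/(untwist_env_ideal hom_lie_g invol_g).
  (* untwist undoes the twist and leaves deg_twist. *)
  rewrite /untwist (twistK invol_g) => IS.
  have S0 : S = 0 by apply: JW0 WS; rewrite -[S]dK; apply: dL.
  exact: W_free S0.
have SE := subspace_image LC (tplus_subspace g).
apply/seteqP; split.
  apply: (lspan_sub SE) => _ [w Ww <-]; exists (twist beta w) => //.
  by apply: twist_tplus; apply: WT; apply: mem_lspan.
move=> _ [v Tv <-]; have : tplus g (twist beta v) by apply: twist_tplus.
rewrite TJW => -[a Ja [b Wb ab]].
have -> : v = twist beta a + twist beta b by rewrite -(linear_add LT) ab (twistK invol_g).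
have Ia : env_ideal br beta (twist beta a).
  have := untwist_lie_ideal hom_lie_g invol_g (dJ _ Ja).
  by rewrite /untwist -(deg_twist_twist invol_g) dK.
rewrite cosetD.
have -> : coset (env_ideal br beta) (twist beta a) = 0.
  rewrite -(linear_zero LC); apply/cosetP.
  by rewrite subr0 lspan_id.
rewrite add0r; move: b Wb {ab}.
apply: (lspan_linear LCT (lspan_subspace _)) => b Wb.
by apply: mem_lspan; exists b.
Qed.
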